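(* Let $a,b,c,d\in\mathbb{R}$ with $ad-bc=1$ and $b\neq 0$, and let $f\in L^2(\mathbb{R})$ be a nonzero (complex-valued) signal with compact support. Let $(\xi_j,-\overline{\xi_j})_{j\ge 1}$ be the zero pairs of the entire function $A\bigl[\theta\, e^{\frac{ia}{2b}(\cdot)^2} f\bigr]$. Then each signal $g\in L^2(\mathbb{R})$ with compact support and $|\mathcal{C}_{(a,b,c,d)}[g]|=|\mathcal{C}_{(a,b,c,d)}[f]|$ on $\mathbb{R}$ is of the form $$\mathcal{L}\bigl[\theta\, e^{\frac{ia}{2b}(\cdot)^2} g\bigr](\zeta)=C\,\zeta^m\,e^{\zeta\gamma}\prod_{j=1}^{\infty}\Bigl(1-\frac{\zeta}{\eta_j}\Bigr)e^{\zeta/\eta_j}\qquad(\zeta\in\mathbb{C}),$$ with complex constants $C,\gamma$ and a nonnegative integer $m$, where the absolute value $|C|$ and the imaginary part $\operatorname{Im}\gamma$ coincide for all such signals $g$, and where, for every $j$, $\eta_j$ is chosen from the zero pair $(\xi_j,-\overline{\xi_j})$, i.e. $\eta_j\in\{\xi_j,-\overline{\xi_j}\}$.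
   Context: For real parameters $a,b,c,d$ with $ad-bc=1$ and $b\ne 0$, the linear canonical transform of a compactly supported $f\in L^2(\mathbb{R})$, $f:\mathbb{R}\to\mathbb{C}$, is $$\mathcal{C}_{(a,b,c,d)}[f](\omega):=\int_{-\infty}^{\infty} f(t)\,K_{(a,b,c,d)}(\omega,t)\,dt,\qquad K_{(a,b,c,d)}(\omega,t):=\frac{1}{\sqrt{2\pi b}}\,e^{-i\pi/4}\,e^{\frac{i}{2}\left(\frac{a}{b}t^2-\frac{2}{b}\omega t+\frac{d}{b}\omega^2\right)},$$ where for $b<0$ the square root $\sqrt{2\pi b}$ is a fixed (e.g. principal) complex square root. Put $\theta:=\frac{1}{\sqrt{2\pi b}}e^{-i\pi/4}$. The notation $e^{\frac{ia}{2b}(\cdot)^2}h$ denotes the function $t\mapsto e^{\frac{ia}{2b}t^2}h(t)$. For a compactly supported $h\in L^2(\mathbb{R})$, the (two-sided) Laplace transform and the autocorrelation function are the entire functions $$\mathcal{L}[h](\zeta):=\int_{-\infty}^{\infty}h(t)\,e^{-\zeta t}\,dt,\qquad A[h](\zeta):=\int_{-\infty}^{\infty}\int_{-\infty}^{\infty}\overline{h(s)}\,h(s+t)\,e^{-\zeta t}\,ds\,dt\qquad(\zeta\in\mathbb{C}).$$ One has $A[h](\zeta)=\mathcal{L}[h](\zeta)\,\overline{\mathcal{L}[h](-\overline{\zeta})}$, so the zeros of $A[h]$ are symmetric under $\zeta\mapsto-\overline{\zeta}$ (and purely imaginary zeros have even multiplicity). The zero pairs of $A[h]$ are the pairs $(\xi_j,-\overline{\xi_j})$,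 $j=1,2,\dots$, into which the nonzero zeros of $A[h]$, listed with multiplicity, are grouped. *)

(* Defs.v *)
From HB Require Import structures.
From mathcomp Require Import all_boot all_order all_algebra.
From mathcomp Require Import all_classical all_reals all_analysis.
From mathcomp Require Import complex.
Import Order.TTheory GRing.Theory Num.Theory.
Import numFieldNormedType.Exports.

Set Implicit Arguments.
Unset Strict Implicit.
Unset Printing Implicit Defensive.

Local Open Scope classical_set_scope.
Local Open Scope card_scope.
Local Open Scope ring_scope.
Local Open Scope complex_scope.

Section Defs.
Context {R : realType}.
Implicit Types (f h : R -> R[i]) (F : R[i] -> R[i]).

Local Notation mu := (@lebesgue_measure R).

Definition cexp (z : R[i]) : R[i] :=
  (expR (complex.Re z))%:C * (cos (complex.Im z) +i* sin (complex.Im z)).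

(* Lebesgue integral over the real line of a complex-valued function; it is
   meaningful when the real and imaginary parts are integrable. *)
Definition Cintegral f : R[i] :=
  Rintegral mu setT (fun t => complex.Re (f t)) +i*
  Rintegral mu setT (fun t => complex.Im (f t)).

(* The compactly supported elements of L^2, each given by any representative;
   the support is therefore the essential one. *)
Definition L2_compact_support f : Prop :=
  [/\ (fun t => complex.Re (f t)) \in Lfun mu 2%:E,
      (fun t => complex.Im (f t)) \in Lfun mu 2%:E
    & exists2 K : set R, compact K & {ae mu, forall t, ~ K t -> f t = 0}].

(* s stands for the fixed square root of 2 pi b, any of the two when b < 0. *)
Definition sqrt_2pib (b : R) (s : R[i]) : Prop :=
  s ^+ 2 = (2 * pi * b)%:C /\ (0 < b -> 0 < s).

Definition theta (s : R[i]) : R[i] := s^-1 * cexp (0 -i* (pi / 4)).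

(* The entry c of the parameter matrix does not occur in the kernel. *)
Definition LCT_kernel (s : R[i]) (a b d omega t : R) : R[i] :=
  theta s *
  cexp (0 +i* ((a / b * t ^+ 2 - 2 / b * omega * t + d / b * omega ^+ 2) / 2)).

Definition LCT (s : R[i]) (a b d : R) f (omega : R) : R[i] :=
  Cintegral (fun t => f t * LCT_kernel s a b d omega t).

Definition theta_chirp (s : R[i]) (a b : R) f : R -> R[i] :=
  fun t => theta s * cexp (0 +i* (a / (2 * b) * t ^+ 2)) * f t.

Definition laplace h (zeta : R[i]) : R[i] :=
  Cintegral (fun t => h t * cexp (- (zeta * t%:C))).

Definition autocorrelation h (zeta : R[i]) : R[i] :=
  Cintegral (fun t => Cintegral (fun s =>
    (h s)^* * h (s + t) * cexp (- (zeta * t%:C)))).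

(* z is a zero of exact order k of the entire function F (k = 0 when F does
   not vanish at z). *)
Definition zero_order F (z : R[i]) (k : nat) : Prop :=
  exists G : R[i] -> R[i],
    [/\ forall w, derivable (G : R[i]^o -> R[i]^o) w 1,
        G z != 0
      & forall w, F w = (w - z) ^+ k * G w].

(* The two components of the pair (xi_j, - conj xi_j), selected by a boolean. *)
Definition pair_elt (xi : nat -> R[i]) (p : nat * bool) : R[i] :=
  if p.2 then - (xi p.1)^* else xi p.1.

(* The entries of the pairs (xi_j, - conj xi_j), over all j, list the nonzero
   zeros of F with multiplicity. *)
Definition zero_pairs F (xi : nat -> R[i]) : Prop :=
  (forall j, xi j != 0) /\
  forall z, z != 0 ->
    exists2 k, zero_order F z k & [set p | pair_elt xi p = z] #= `I_k.

Definition product_form F (xi : nat -> R[i]) (C gamma : R[i]) (m : nat)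
    (eta : nat -> R[i]) : Prop :=
  (forall j, eta j = xi j \/ eta j = - (xi j)^*) /\
  forall zeta, exists2 P : R[i],
    (fun n => \prod_(0 <= j < n)
       ((1 - zeta / eta j) * cexp (zeta / eta j)) : R[i]^o) @ \oo --> (P : R[i]^o)
    & F zeta = C * zeta ^+ m * cexp (zeta * gamma) * P.

End Defs.

(* Main.v *)
(** Write [F_h] for the Laplace transform of [h].  Up to unimodular factors the
    linear canonical transform of [g] at [b y] is [F_h (i y)], where [h] is the
    chirped [g], and [A[h] (z) = F_h (z) conj (F_h (- conj z))] equals
    [|F_h|^2] on the imaginary axis.  Both sides being everywhere convergent
    power series, all admissible [g] share the same [A], hence the zero pairs.

    Hadamard's factorization is obtained without complex analysis.  If
    [F = sum c_n z^n] with [c_0 = 1] and [|c_n| <= M T^n / n!], each Taylor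
    polynomial factors as [prod (1 - u_j z)] with [|u_j|] decreasing, and
    Landau's inequality (a finite product of [|u_j|] is at most the l2 norm of
    the coefficients), applied to [F (r z)] with [r = j + 1], gives
    [|u_j| <= M e^T / (j + 1)] uniformly in the degree.  A limit of the [u_j]
    along an ultrafilter then yields
    [F (z) = e^(c_1 z) lim prod_(j < n) (1 - u_j z) e^(u_j z)].

    Comparing orders of vanishing of [A] at [z] matches the [1 / u_j] with the
    zero pairs, class by class; the product is absolutely convergent and may be
    rearranged along this matching.  Finally, on the imaginary axis the modulus
    of a factor does not depend on the chosen element of the pair, so
    [|F (i y)| = |C| |y|^m e^(- y Im gamma) Q (y)] with a common [Q], and small
    [y] of both signs determine [|C|] and [Im gamma]. *)
Require Import Defs.
From mathcomp Require Import all_boot all_order all_algebra.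
From mathcomp Require Import all_classical all_reals all_analysis.
From mathcomp Require Import measurable_realfun complex ring lra.
Import Order.TTheory GRing.Theory Num.Theory.
Import numFieldNormedType.Exports.
Import ComplexField.Normc.

Set Implicit Arguments.
Unset Strict Implicit.
Unset Printing Implicit Defensive.

Local Open Scope classical_set_scope.
Local Open Scope ring_scope.
Local Open Scope complex_scope.

(** * Modulus, exponential and limits of complex numbers *)

Section ComplexModulus.
Context {R : realType}.
Implicit Types (x y z w : R[i]) (r : R).

Lemma normr_normc z : `|z| = (normc z)%:C.
Proof. by case: z. Qed.

Lemma normc_ge0 z : 0 <= normc z.
Proof. by case: z => a b /=; exact: sqrtr_ge0. Qed.

Lemma normc_eq0 z : (normc z == 0) = (z == 0).
Proof. by apply/eqP/eqP => [/eq0_normc|->]; [|exact: normc0]. Qed.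

Lemma normc_gt0 z : (0 < normc z) = (z != 0).
Proof. by rewrite lt_def normc_ge0 andbT normc_eq0. Qed.

Lemma le_normcB x y : normc (x - y) <= normc x + normc y.
Proof. by apply: le_trans (le_normcD _ _) _; rewrite normcN. Qed.

Lemma normc_distC x y : normc (x - y) = normc (y - x).
Proof. by rewrite -normcN opprB. Qed.

Lemma le_normc_dist x y : `|normc x - normc y| <= normc (x - y).
Proof.
rewrite ler_norml; apply/andP; split.
  rewrite lerNl opprB lerBlDr -(normcN (x - y)) opprB.
  by apply: le_trans (le_normcD _ _); rewrite subrK.
by rewrite lerBlDr; apply: le_trans (le_normcD _ _); rewrite subrK.
Qed.

Lemma normcX z n : normc (z ^+ n) = normc z ^+ n.
Proof. by elim: n => [|n IH]; rewrite ?expr0 ?normc1// !exprS normcM IH. Qed.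

Lemma normc_prod (I : Type) (s : seq I) (P : pred I) (F : I -> R[i]) :
  normc (\prod_(i <- s | P i) F i) = \prod_(i <- s | P i) normc (F i).
Proof. elim/big_rec2: _ => [|i x y _ <-]; [exact: normc1 | by rewrite normcM]. Qed.

Lemma le_normc_sum (I : Type) (s : seq I) (P : pred I) (F : I -> R[i]) :
  normc (\sum_(i <- s | P i) F i) <= \sum_(i <- s | P i) normc (F i).
Proof.
elim/big_rec2: _ => [|i x y _ ih]; first by rewrite normc0.
by rewrite (le_trans (le_normcD _ _))// lerD2l.
Qed.

(* The notation [z^*] denotes [Num.conj z] in ring_scope and [conjc z] in
   complex_scope. *)
Lemma conjCE z : Num.conj z = conjc z.
Proof. by []. Qed.

Lemma conjcM x y : conjc (x * y) = conjc x * conjc y.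
Proof. exact: (rmorphM (@conjc R)). Qed.

Lemma normc_conj z : normc z^* = normc z.
Proof. by case: z => a b /=; rewrite sqrrN. Qed.

Lemma normc_real r : normc r%:C = `|r|.
Proof. by rewrite /= expr0n/= addr0 sqrtr_sqr. Qed.

Lemma normc_imag r : normc (0 +i* r) = `|r|.
Proof. by rewrite /= expr0n/= add0r sqrtr_sqr. Qed.

Lemma normc_nat n : normc (n%:R : R[i]) = n%:R.
Proof. by rewrite -(rmorph_nat (real_complex R)) normc_real ger0_norm. Qed.

Lemma normc_sqr z : normc z ^+ 2 = complex.Re z ^+ 2 + complex.Im z ^+ 2.
Proof. by case: z => a b /=; rewrite sqr_sqrtr// addr_ge0 ?sqr_ge0. Qed.

Lemma Re_le_normc z : `|complex.Re z| <= normc z.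
Proof.
by case: z => a b /=; rewrite -sqrtr_sqr ler_wsqrtr// lerDl sqr_ge0.
Qed.

Lemma Im_le_normc z : `|complex.Im z| <= normc z.
Proof.
by case: z => a b /=; rewrite -sqrtr_sqr ler_wsqrtr// lerDr sqr_ge0.
Qed.

Lemma normc_le_ReIm z : normc z <= `|complex.Re z| + `|complex.Im z|.
Proof.
rewrite -(@ler_pXn2r _ 2)// ?nnegrE ?addr_ge0 ?normc_ge0//.
rewrite normc_sqr sqrrD !real_normK ?num_real//.
by rewrite -addrA lerD2l lerDr mulrn_wge0// mulr_ge0.
Qed.

Lemma cexp0 : cexp 0 = 1 :> R[i].
Proof. by rewrite /cexp /= expR0 cos0 sin0 mul1r. Qed.

Lemma cexpD z w : cexp (z + w) = cexp z * cexp w.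
Proof.
case: z => a b; case: w => c d; rewrite /cexp /= expRD cosD sinD.
by simpc; congr (_ +i* _); ring.
Qed.

Lemma cexp_sum (I : Type) (s : seq I) (P : pred I) (F : I -> R[i]) :
  cexp (\sum_(i <- s | P i) F i) = \prod_(i <- s | P i) cexp (F i).
Proof. by elim/big_rec2: _ => [|i x y _ <-]; [exact: cexp0 | rewrite cexpD]. Qed.

Lemma normc_cexp z : normc (cexp z) = expR (complex.Re z).
Proof.
rewrite /cexp normcM normc_real ger0_norm ?expR_ge0//.
by rewrite [X in _ * X]/= cos2Dsin2 sqrtr1 mulr1.
Qed.

Lemma normc_cexp_le z : normc (cexp z) <= expR (normc z).
Proof. by rewrite normc_cexp ler_expR (le_trans (ler_norm _))// Re_le_normc. Qed.

Lemma cexp_neq0 z : cexp z != 0.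
Proof. by rewrite -normc_gt0 normc_cexp expR_gt0. Qed.

Lemma cexpN z : cexp (- z) = (cexp z)^-1.
Proof. by apply: (mulfI (cexp_neq0 z)); rewrite -cexpD subrr cexp0 divff ?cexp_neq0. Qed.

Lemma cexp_conj z : cexp z^* = (cexp z)^*.
Proof.
by case: z => a b; rewrite /cexp /= cosN sinN; simpc.
Qed.

End ComplexModulus.

(** * Convergence of complex values along a filter *)

Section ComplexConvergence.
Context {R : realType}.

(** Convergence is expressed by a real limit of moduli, along any filter, so that the squeeze and
    order lemmas of [R] apply; [cvg_ccvgP] translates to the topology of [R[i]^o]. *)
Definition ccvg {T : Type} (F : set_system T) (u : T -> R[i]) (l : R[i]) :=
  normc (u x - l) @[x --> F] --> (0 : R).

Context {T : Type} {F : set_system T} {FF : ProperFilter F}.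
Implicit Types (u v : T -> R[i]) (l m : R[i]).

Lemma ccvg_squeeze u l (e : T -> R) :
  (\forall x \near F, normc (u x - l) <= e x) -> e x @[x --> F] --> (0 : R) -> ccvg F u l.
Proof.
move=> ue e0; apply: (squeeze_cvgr _ (cvg_cst 0) e0).
by near=> x; rewrite normc_ge0/=; near: x.
Unshelve. all: end_near. Qed.

Lemma ccvg_cst l : ccvg F (fun=> l) l.
Proof. by rewrite /ccvg subrr normc0; exact: cvg_cst. Qed.

Lemma ccvg_norm u l : ccvg F u l -> normc (u x) @[x --> F] --> normc l.
Proof.
move=> ul; apply/subr_cvg0/norm_cvg0P/(squeeze_cvgr _ (cvg_cst 0) ul).
by near=> x; rewrite normr_ge0/= le_normc_dist.
Unshelve. all: end_near. Qed.

Lemma ccvg_unique u l m : ccvg F u l -> ccvg F u m -> l = m.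
Proof.
move=> ul um; apply/eqP; rewrite -subr_eq0 -normc_eq0.
have h : (normc (u x - l) + normc (u x - m)) @[x --> F] --> (0 : R).
  by rewrite -[0 in X in _ --> X](addr0 0); exact: cvgD.
rewrite eq_le normc_ge0 andbT; apply: (cvgr_to_ge h).
near=> x; rewrite (_ : l - m = (u x - m) - (u x - l)); last by ring.
by rewrite (le_trans (le_normcB _ _))// addrC.
Unshelve. all: end_near. Qed.

Lemma eq_ccvg u v l : u =1 v -> ccvg F u l -> ccvg F v l.
Proof. by move=> /funext ->. Qed.

Lemma ccvgD u v l m :
  ccvg F u l -> ccvg F v m -> ccvg F (fun x => u x + v x) (l + m).
Proof.
move=> ul vm; apply: (@ccvg_squeeze _ _ (fun x => normc (u x - l) + normc (v x - m))).
  near=> x; rewrite (_ : _ - _ = (u x - l) + (v x - m)); last by ring.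
  exact: le_normcD.
by rewrite -[0 in X in _ --> X](addr0 0); exact: cvgD.
Unshelve. all: end_near. Qed.

Lemma ccvgM u v l m :
  ccvg F u l -> ccvg F v m -> ccvg F (fun x => u x * v x) (l * m).
Proof.
move=> ul vm; apply: (@ccvg_squeeze _ _ (fun x => normc (u x - l) * normc (v x) + normc l * normc (v x - m))).
  near=> x; rewrite (_ : _ - _ = (u x - l) * v x + l * (v x - m)); last by ring.
  by rewrite -!normcM; exact: le_normcD.
have := cvgD (cvgM ul (ccvg_norm vm)) (cvgM (cvg_cst (normc l)) vm).
by rewrite mul0r mulr0 addr0; apply.
Unshelve. all: end_near. Qed.

Lemma ccvgN u l : ccvg F u l -> ccvg F (fun x => - u x) (- l).
Proof.
by rewrite /ccvg => h; under eq_fun do rewrite -opprD normcN.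
Qed.

Lemma ccvgB u v l m :
  ccvg F u l -> ccvg F v m -> ccvg F (fun x => u x - v x) (l - m).
Proof. by move=> ul vm; apply: ccvgD => //; exact: ccvgN. Qed.

Lemma ccvg_conj u l : ccvg F u l -> ccvg F (fun x => (u x)^*) l^*.
Proof.
by rewrite /ccvg => h; under eq_fun do rewrite -rmorphB normc_conj.
Qed.

Lemma ccvg_prod (I : Type) (s : seq I) (P : pred I) (f : I -> T -> R[i]) (l : I -> R[i]) :
  (forall i, ccvg F (f i) (l i)) ->
  ccvg F (fun x => \prod_(i <- s | P i) f i x) (\prod_(i <- s | P i) l i).
Proof.
move=> fl; elim: s => [|i s IH].
  by rewrite big_nil; under eq_fun do rewrite big_nil; exact: ccvg_cst.
rewrite big_cons; under eq_fun do rewrite big_cons.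
by case: (P i) => //; exact: ccvgM.
Qed.

Lemma ccvg_ReIm u l :
  (complex.Re (u x) @[x --> F] --> complex.Re l) ->
  (complex.Im (u x) @[x --> F] --> complex.Im l) -> ccvg F u l.
Proof.
move=> re im; apply: (@ccvg_squeeze _ _ (fun x => `|complex.Re (u x) - complex.Re l| + `|complex.Im (u x) - complex.Im l|)).
  near=> x; apply: le_trans (normc_le_ReIm _) _.
  by case: (u x) => a b; case: (l).
rewrite -[0 in X in _ --> X](addr0 0).
by apply: cvgD; apply/norm_cvg0P/subr_cvg0.
Unshelve. all: end_near. Qed.

Lemma ccvg_le u l (e : R) :
  ccvg F u l -> (\forall x \near F, normc (u x) <= e) -> normc l <= e.
Proof. by move=> ul; apply: cvgr_to_le; exact: ccvg_norm. Qed.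

Lemma ccvg_ge u l (e : R) :
  ccvg F u l -> (\forall x \near F, e <= normc (u x)) -> e <= normc l.
Proof. by move=> ul; apply: cvgr_to_ge; exact: ccvg_norm. Qed.

Lemma cvg_ccvgP u l :
  ((u : T -> R[i]^o) @ F --> (l : R[i]^o)) <-> ccvg F u l.
Proof.
split.
  move=> /cvgrPdist_le ul; apply/cvgrPdist_le => e e0.
  have := ul e%:C; rewrite ltcR => /(_ e0); apply: filterS => x.
  by rewrite normr_normc sub0r normrN (ger0_norm (normc_ge0 _)) (normc_distC l) lecR.
(* A positive radius in [R[i]] has zero imaginary part, hence is a real radius. *)
move=> /cvgrPdist_le ul; apply/cvgrPdist_le => -[e e'].
rewrite ltcE/= => /andP[/eqP -> e0].
have := ul e e0; apply: filterS => x.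
by rewrite normr_normc sub0r normrN (ger0_norm (normc_ge0 _)) (normc_distC l) lecR.
Qed.

End ComplexConvergence.

(** * The exponential series and primary factors *)

Section ExponentialSeries.
Context {R : realType}.
Implicit Types (z w : R[i]) (x y r : R).

(** The square of index pairs splits into the triangle [i + j < n], which is the partial Cauchy
    product, and the rest, which is the defect estimated below. *)
Lemma sum_mul_triangle (F : comNzRingType) (a b : nat -> F) n :
  (\sum_(0 <= i < n) a i) * (\sum_(0 <= j < n) b j) =
  \sum_(0 <= k < n) \sum_(0 <= i < k.+1) a i * b (k - i)%N
  + \sum_(0 <= i < n) a i * \sum_(n - i <= j < n) b j.
Proof.
have tri m : \sum_(0 <= k < m) \sum_(0 <= i < k.+1) a i * b (k - i)%N =
    \sum_(0 <= i < m) a i * \sum_(0 <= j < m - i) b j.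
  elim: m => [|m IH]; first by rewrite !big_nil.
  rewrite big_nat_recr//= IH [RHS]big_nat_recr//= [X in _ + X = _]big_nat_recr//=.
  rewrite addrA -big_split/= subnn subSnn big_nat1; congr (_ + _).
  apply: eq_big_nat => i /andP[_ im].
  by rewrite (subSn (ltnW im)) big_nat_recr//= mulrDr.
rewrite tri -big_split/= big_distrl/=.
apply: eq_big_nat => i /andP[_ im]; rewrite -mulrDr.
by rewrite -(big_cat_nat _ (leq_subr i n))//.
Qed.

Lemma binomial_factorial (F : numFieldType) (x y : F) k :
  \sum_(0 <= i < k.+1) x ^+ i / i`!%:R * (y ^+ (k - i) / (k - i)`!%:R) =
  (x + y) ^+ k / k`!%:R.
Proof.
rewrite addrC exprDn big_distrl/= big_mkord; apply: eq_bigr => i _.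
have ik : (i <= k)%N by rewrite -ltnS.
have f0 m : (m`!%:R : F) != 0 by rewrite pnatr_eq0 -lt0n fact_gt0.
rewrite -(bin_fact ik) 2!natrM -mulr_natr.
have b0 : ('C(k, i)%:R : F) != 0 by rewrite pnatr_eq0 -lt0n bin_gt0.
by field; rewrite !f0 b0.
Qed.

Lemma expR_series x :
  (fun n => \sum_(0 <= k < n) x ^+ k / k`!%:R) @ \oo --> expR x.
Proof. exact: (@is_cvg_series_exp_coeff R x). Qed.

Lemma expR_partial_sum_le x n :
  0 <= x -> \sum_(0 <= k < n) x ^+ k / k`!%:R <= expR x.
Proof.
move=> x0; have := @nondecreasing_cvgn_le R
  (fun n => \sum_(0 <= k < n) x ^+ k / k`!%:R); apply.
  apply/nondecreasing_seqP => m; rewrite big_nat_recr//= lerDl.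
  by rewrite divr_ge0// exprn_ge0.
exact: (@is_cvg_series_exp_coeff R x).
Qed.

Lemma cauchy_product_defect (a b : nat -> R[i]) (A B S T : R) :
  0 <= S -> 0 <= T ->
  (forall n, normc (a n) <= A * (S ^+ n / n`!%:R)) ->
  (forall n, normc (b n) <= B * (T ^+ n / n`!%:R)) ->
  ccvg \oo (fun n => (\sum_(0 <= i < n) a i) * (\sum_(0 <= j < n) b j) -
    \sum_(0 <= k < n) \sum_(0 <= i < k.+1) a i * b (k - i)%N) 0.
Proof.
move=> S0 T0 ha hb.
(* The defect is at most that of the majorants, which tends to
   [A B (e^S e^T - e^(S + T)) = 0]. *)
have addpK (V : zmodType) (x y : V) : x + y - x = y by rewrite addrC addKr.
pose s n := S ^+ n / n`!%:R; pose t n := T ^+ n / n`!%:R.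
pose d n := A * B * ((\sum_(0 <= i < n) s i) * (\sum_(0 <= j < n) t j) -
   \sum_(0 <= k < n) \sum_(0 <= i < k.+1) s i * t (k - i)%N).
apply: (@ccvg_squeeze _ _ _ _ _ _ d).
  near=> n; rewrite /d !sum_mul_triangle !addpK subr0.
  apply: le_trans (le_normc_sum _ _ _) _.
  rewrite mulr_sumr; apply: ler_sum => i _; rewrite normcM mulrACA.
  apply: ler_pM => //; rewrite ?normc_ge0//.
  apply: le_trans (le_normc_sum _ _ _) _.
  by rewrite mulr_sumr; apply: ler_sum => j _.
have -> : (0 : R) = A * B * (expR S * expR T - expR (S + T)).
  by rewrite expRD subrr mulr0.
apply: cvgM; first exact: cvg_cst.
apply: cvgB; first by apply: cvgM; exact: expR_series.
under eq_fun do under eq_bigr do rewrite binomial_factorial.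
exact: expR_series.
Unshelve. all: end_near. Qed.

Lemma cauchy_product (a b : nat -> R[i]) (la lb : R[i]) (A B S T : R) :
  0 <= S -> 0 <= T ->
  (forall n, normc (a n) <= A * (S ^+ n / n`!%:R)) ->
  (forall n, normc (b n) <= B * (T ^+ n / n`!%:R)) ->
  ccvg \oo (fun n => \sum_(0 <= i < n) a i) la ->
  ccvg \oo (fun n => \sum_(0 <= i < n) b i) lb ->
  ccvg \oo (fun n => \sum_(0 <= k < n) \sum_(0 <= i < k.+1) a i * b (k - i)%N)
    (la * lb).
Proof.
move=> S0 T0 ha hb ala blb; rewrite -[la * lb]subr0.
apply: eq_ccvg (ccvgB (ccvgM ala blb) (cauchy_product_defect S0 T0 ha hb)) => n.
by rewrite opprB addrC subrK.
Qed.

Lemma Re_sum (I : Type) (s : seq I) (P : pred I) (F : I -> R[i]) :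
  complex.Re (\sum_(i <- s | P i) F i) = \sum_(i <- s | P i) complex.Re (F i).
Proof. by elim/big_rec2: _ => // i x y _ <-; case: (F i) => a b; case: y. Qed.

Lemma Im_sum (I : Type) (s : seq I) (P : pred I) (F : I -> R[i]) :
  complex.Im (\sum_(i <- s | P i) F i) = \sum_(i <- s | P i) complex.Im (F i).
Proof. by elim/big_rec2: _ => // i x y _ <-; case: (F i) => a b; case: y. Qed.

Lemma complexMn_real (a b r : R) : (a +i* b) * r%:C = (a * r) +i* (b * r).
Proof. by simpc. Qed.

Lemma complex_div_nat (a b : R) n : (a +i* b) / n%:R = (a / n%:R) +i* (b / n%:R).
Proof. by rewrite -(rmorph_nat (real_complex R)) -fmorphV complexMn_real. Qed.

(** The parity factors are those of the cosine and sine coefficients, so that [cexp_series] can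
    compare the series term by term. *)
Lemma imaginary_exp y k : (0 +i* y) ^+ k =
  ((~~ odd k)%:R * (-1) ^+ k./2 * y ^+ k) +i* ((odd k)%:R * (-1) ^+ k.-1./2 * y ^+ k).
Proof.
have even m : (0 +i* y) ^+ (m.*2) = ((-1) ^+ m * y ^+ m.*2)%:C.
  rewrite -mul2n !exprM rmorphM !rmorphXn/= -exprMn; congr (_ ^+ _).
  by rewrite expr2; simpc; congr (_ +i* _); ring.
rewrite -[k]odd_double_half; case: (odd k); rewrite /= ?add0n ?add1n /=.
  rewrite uphalf_double odd_double/= doubleK exprS even; simpc.
  by rewrite exprS; congr (_ +i* _); ring.
by rewrite odd_double/= doubleK even; simpc.
Qed.

(** The series of [x + i y] is the Cauchy product of those of [x] and [i y]; the latter splits by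
    parity into the cosine and sine series. *)
Lemma cexp_series z :
  ccvg \oo (fun n => \sum_(0 <= k < n) z ^+ k / k`!%:R) (cexp z).
Proof.
have normc_term w n : normc (w ^+ n / n`!%:R) <= 1 * (normc w ^+ n / n`!%:R).
  by rewrite mul1r normcM normcV normcX normc_nat.
case: z => x y; rewrite (_ : x +i* y = x%:C + (0 +i* y)); last first.
  by simpc.
under eq_fun do under eq_bigr do rewrite -binomial_factorial.
have -> : cexp (x%:C + (0 +i* y)) = (expR x)%:C * (cos y +i* sin y).
  by rewrite /cexp; simpc.
have eq_cvgR (u v : nat -> R) (l : R) : u =1 v -> v @ \oo --> l -> u @ \oo --> l.
  by move=> /funext ->.
apply: (cauchy_product (normc_ge0 x%:C) (normc_ge0 (0 +i* y)) (normc_term _) (normc_term _)).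
  apply: ccvg_ReIm.
    apply: (eq_cvgR _ _ (expR x) _ (@expR_series x)) => n.
    rewrite Re_sum; apply: eq_bigr => k _.
    by rewrite -rmorphXn complex_div_nat.
  apply: (eq_cvgR _ _ 0 _ (cvg_cst 0)) => n.
  rewrite Im_sum big1// => k _.
  by rewrite -rmorphXn complex_div_nat/= mul0r.
apply: ccvg_ReIm.
  have c : series (cos_coeff y) @ \oo --> cos y.
    by have := @is_cvg_series_cos_coeff R y; rewrite cos.unlock.
  apply: (eq_cvgR _ _ (cos y) _ c) => n; rewrite Re_sum; apply: eq_bigr => k _.
  by rewrite imaginary_exp complex_div_nat.
have c : series (sin_coeff y) @ \oo --> sin y.
  by have := @is_cvg_series_sin_coeff R y; rewrite sin.unlock.
apply: (eq_cvgR _ _ (sin y) _ c) => n; rewrite Im_sum; apply: eq_bigr => k _.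
by rewrite imaginary_exp complex_div_nat.
Qed.

(** The terms of degree at least [N] are bounded in modulus by those of the real series at [r]. *)
Lemma normc_cexp_remainder w r N : normc w <= r ->
  normc (cexp w - \sum_(0 <= k < N) w ^+ k / k`!%:R) <=
  expR r - \sum_(0 <= k < N) r ^+ k / k`!%:R.
Proof.
move=> wr; have r0 : 0 <= r := le_trans (normc_ge0 w) wr.
apply: (ccvg_le (ccvgB (cexp_series w) (ccvg_cst _))).
exists N => // n /= Nn; rewrite (big_cat_nat (leq0n N) Nn)/= addrAC subrr add0r.
apply: le_trans (le_normc_sum _ _ _) _.
rewrite lerBrDl; apply: le_trans (expR_partial_sum_le n r0).
rewrite [leRHS](big_cat_nat (leq0n N) Nn)/= lerD2l; apply: ler_sum => k _.
rewrite normcM normcV normcX normc_nat ler_wpM2r ?invr_ge0//.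
by rewrite lerXn2r ?nnegrE// normc_ge0.
Qed.

Lemma expR_sub1_le r : 0 <= r -> expR r - 1 <= r * expR r.
Proof.
move=> r0; have := expR_ge1Dx (- r); rewrite -(ler_pM2r (expR_gt0 r)).
by rewrite -expRD addNr expR0; lra.
Qed.

Lemma normc_cexp_sub1 w : normc (cexp w - 1) <= normc w * expR (normc w).
Proof.
have := normc_cexp_remainder 1 (lexx (normc w)).
rewrite !big_nat1 !expr0 !divr1 => /le_trans; apply.
exact: expR_sub1_le (normc_ge0 w).
Qed.

Lemma normc_cexp_sub1_sub w :
  normc (cexp w - 1 - w) <= normc w ^+ 2 * expR (normc w).
Proof.
have := normc_cexp_remainder 2 (lexx (normc w)).
rewrite !big_nat_recr//= !big_nil !expr0 !divr1 !add0r !opprD !addrA => /le_trans; apply.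
have := expR_sub1_le (normc_ge0 w); have := normc_ge0 w; nra.
Qed.

(* The Weierstrass primary factor of genus one. *)
Definition efactor w : R[i] := (1 - w) * cexp w.

Lemma efactor0 : efactor 0 = 1.
Proof. by rewrite /efactor subr0 cexp0 mul1r. Qed.

Lemma efactor_conj w : efactor w^* = (efactor w)^*.
Proof. by rewrite /efactor cexp_conj [RHS]rmorphM/= rmorphB rmorph1. Qed.

(** The linear terms of [1 - w] and [e^w] cancel, which leaves a quadratic error; reciprocal zeros
    of size [O(1 / j)] therefore give a convergent product. *)
Lemma normc_efactor_sub1 w :
  normc (efactor w - 1) <= 2 * (normc w ^+ 2 * expR (normc w)).
Proof.
rewrite /efactor (_ : _ - 1 = (cexp w - 1 - w) - w * (cexp w - 1)); last by ring.
apply: le_trans (le_normcB _ _) _; rewrite normcM.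
have := normc_cexp_sub1_sub w; have := normc_cexp_sub1 w; have := normc_ge0 w; nra.
Qed.

(** By induction, from [|x p - 1| <= |x - 1| |p - 1| + |x - 1| + |p - 1|] and [1 + t <= e^t]. *)
Lemma normc_prod_sub1 (I : Type) (s : seq I) (P : pred I) (F : I -> R[i]) :
  normc (\prod_(i <- s | P i) F i - 1) <=
  expR (\sum_(i <- s | P i) normc (F i - 1)) - 1.
Proof.
elim/big_rec2: _ => [|i x p _ IH]; first by rewrite subrr normc0 expR0 subrr.
rewrite (_ : F i * p - 1 = (F i - 1) * (p - 1) + (F i - 1) + (p - 1)); last by ring.
apply: le_trans (le_normcD _ _) _.
apply: le_trans (lerD (le_normcD _ _) (lexx _)) _; rewrite normcM expRD.
have := expR_ge1Dx (normc (F i - 1)); have := normc_ge0 (F i - 1).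
have := normc_ge0 (p - 1); nra.
Qed.

End ExponentialSeries.

(** * Reciprocal roots of polynomials *)

Section LandauInequality.
Context {R : realType}.
Implicit Types (U : seq R[i]) (p h : {poly R[i]}) (u : R[i]).

Definition sqnorm_coef n p : R := \sum_(0 <= i < n) normc p`_i ^+ 2.

(** The entries are reciprocal roots; an entry 0 contributes the factor 1, so a list may be padded
    with zeros. *)
Definition inv_root_poly U : {poly R[i]} := \prod_(u <- U) (1 - u%:P * 'X).

Lemma inv_root_poly_cons u U : inv_root_poly (u :: U) = (1 - u%:P * 'X) * inv_root_poly U.
Proof. exact: big_cons. Qed.

Lemma coef0_mul_linear u h : ((1 - u%:P * 'X) * h)`_0 = h`_0.
Proof. by rewrite mulrBl mul1r coefB -mulrA coefCM coefXM mulr0 subr0. Qed.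

Lemma coefS_mul_linear u h i : ((1 - u%:P * 'X) * h)`_i.+1 = h`_i.+1 - u * h`_i.
Proof. by rewrite mulrBl mul1r coefB -mulrA coefCM coefXM. Qed.

Lemma coef0_mul_conj_linear u h : ((u^*%:P - 'X) * h)`_0 = u^* * h`_0.
Proof. by rewrite mulrBl coefB coefCM coefXM subr0. Qed.

Lemma coefS_mul_conj_linear u h i :
  ((u^*%:P - 'X) * h)`_i.+1 = u^* * h`_i.+1 - h`_i.
Proof. by rewrite mulrBl coefB coefCM coefXM. Qed.

(** The cross terms of [|h_(i+1) - u h_i|^2] and [|conj u h_(i+1) - h_i|^2] coincide, so the
    difference is [(1 - |u|^2) (|h_(i+1)|^2 - |h_i|^2)], which telescopes; the size bound makes
    [h_n] vanish. *)
Lemma sqnorm_coef_reflect n u h : (size h <= n)%N ->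
  sqnorm_coef n.+1 ((1 - u%:P * 'X) * h) = sqnorm_coef n.+1 ((u^*%:P - 'X) * h).
Proof.
move=> hn; rewrite /sqnorm_coef !big_nat_recl//=.
rewrite coef0_mul_linear coef0_mul_conj_linear normcM normc_conj.
apply/eqP; rewrite -subr_eq0; apply/eqP.
rewrite opprD addrACA -sumrB.
under eq_bigr => i _.
  rewrite coefS_mul_linear coefS_mul_conj_linear.
  rewrite (_ : _ - _ = (1 - normc u ^+ 2) * (normc h`_i.+1 ^+ 2 - normc h`_i ^+ 2)); last first.
    rewrite !normc_sqr; case: u => a b; case: (h`_i) => x y; case: (h`_i.+1) => x' y'.
    by simpc => /=; ring.
  over.
rewrite -mulr_sumr telescope_sumr// (nth_default 0 hn) normc0; ring.
Qed.

Lemma size_mul_linear u h : (size ((1 - u%:P * 'X) * h)%R <= (size h).+1)%N.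
Proof.
rewrite mulrBl mul1r (leq_trans (size_polyD _ _))// geq_max leqnSn size_polyN.
rewrite -mulrA; have [->|u0] := eqVneq u 0; first by rewrite mul0r size_poly0.
rewrite size_Cmul//; have [->|h0] := eqVneq h 0; first by rewrite mulr0 size_poly0.
by rewrite mulrC size_mulX ?ltnSn.
Qed.

Lemma size_mul_conj_linear u h : (size ((u^*%:P - 'X) * h)%R <= (size h).+1)%N.
Proof.
rewrite mulrBl (leq_trans (size_polyD _ _))// geq_max size_polyN.
have [->|h0] := eqVneq h 0; first by rewrite !mulr0 size_poly0.
rewrite [in X in _ && X]mulrC size_mulX// leqnn andbT mul_polyC.
by rewrite (leq_trans (size_scale_leq _ _)).
Qed.

Lemma size_conj_inv_root_poly U h :
  (size (\prod_(u <- U) (u^*%:P - 'X) * h)%R <= size U + size h)%N.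
Proof.
elim: U => [|u U IH]; first by rewrite big_nil mul1r.
by rewrite big_cons -mulrA (leq_trans (size_mul_conj_linear _ _)).
Qed.

Lemma sqnorm_coef_reflect_all n U h : (size U + size h <= n)%N ->
  sqnorm_coef n (inv_root_poly U * h) = sqnorm_coef n (\prod_(u <- U) (u^*%:P - 'X) * h).
Proof.
elim: U h => [|u U IH] h; first by rewrite /inv_root_poly !big_nil.
rewrite addSn => Un; rewrite inv_root_poly_cons -mulrA mulrCA IH; last first.
  by rewrite (leq_trans _ Un)// -addnS leq_add2l size_mul_linear.
rewrite big_cons mulrCA -mulrA; case: n {IH} Un => // n; rewrite ltnS => Un.
by rewrite sqnorm_coef_reflect// (leq_trans (size_conj_inv_root_poly _ _)).
Qed.

Lemma inv_root_poly0 U : (inv_root_poly U)`_0 = 1.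
Proof.
by elim: U => [|u U IH]; rewrite ?inv_root_poly_cons ?coef0_mul_linear// /inv_root_poly big_nil coef1.
Qed.

Lemma size_inv_root_poly U : (size (inv_root_poly U) <= (size U).+1)%N.
Proof.
elim: U => [|u U IH]; first by rewrite /inv_root_poly big_nil size_poly1.
by rewrite inv_root_poly_cons (leq_trans (size_mul_linear _ _)).
Qed.

(* Replacing [1 - u X] by the reciprocal factor [u^* - X] preserves the sum of
   the squared moduli of the coefficients; the constant coefficient of the
   resulting polynomial is the product on the left. *)
Lemma landau_inequality U V n : (size U + size V < n)%N ->
  \prod_(u <- U) normc u ^+ 2 <= sqnorm_coef n (inv_root_poly (U ++ V)).
Proof.
move=> UVn; rewrite /inv_root_poly big_cat/= sqnorm_coef_reflect_all; last first.
  by rewrite (leq_trans _ UVn)// -addnS leq_add2l size_inv_root_poly.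
rewrite /sqnorm_coef; case: n UVn => // n _; rewrite big_nat_recl//=.
rewrite coef0M inv_root_poly0 mulr1 -horner_coef0 horner_prod.
have -> : normc (\prod_(u <- U) (u^*%:P - 'X).[0]) = \prod_(u <- U) normc u.
  by rewrite normc_prod; apply: eq_bigr => u _; rewrite !hornerE subr0 normc_conj.
rewrite prodrXl.
by rewrite lerDl sumr_ge0// => i _; rewrite sqr_ge0.
Qed.

Lemma coef_inv_root_poly_scale (r : R[i]) U i :
  (inv_root_poly [seq r * u | u <- U])`_i = r ^+ i * (inv_root_poly U)`_i.
Proof.
elim: U i => [|u U IH] i.
  by rewrite /inv_root_poly !big_nil coef1; case: i => [|i]; rewrite ?mulr0 ?expr0 ?mul1r.
rewrite /= !inv_root_poly_cons; case: i => [|i].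
  by rewrite !coef0_mul_linear IH.
by rewrite !coefS_mul_linear !IH exprS; ring.
Qed.

Lemma inv_root_poly_coef1 U : (inv_root_poly U)`_1 = - \sum_(u <- U) u.
Proof.
elim: U => [|u U IH]; first by rewrite /inv_root_poly !big_nil coef1 oppr0.
by rewrite inv_root_poly_cons coefS_mul_linear IH inv_root_poly0 big_cons mulr1 opprD addrC.
Qed.

Lemma horner_inv_root_poly U z : (inv_root_poly U).[z] = \prod_(u <- U) (1 - u * z).
Proof. by rewrite horner_prod; apply: eq_bigr => u _; rewrite !hornerE. Qed.

(** Roots exist because [R[i]] is algebraically closed, and 0 is not among them. Each [X - x] is
    [- x (1 - X / x)], and comparing constant terms shows that the scalars multiply to 1. *)
Lemma inv_root_factorization p : p`_0 = 1 ->
  exists2 U, p = inv_root_poly U & (size U < size p)%N.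
Proof.
move=> p0; have [r pE] := closed_field_poly_normal p.
have pn0 : p != 0 by apply: contra_eq_neq p0 => ->; rewrite coef0 eq_sym oner_neq0.
have lp0 : lead_coef p != 0 by rewrite lead_coef_eq0.
have r0 : 0 \notin r.
  apply/negP => r0; have : root p 0 by rewrite pE rootZ// root_prod_XsubC.
  by rewrite rootE horner_coef0 p0 oner_eq0.
exists [seq x^-1 | x <- r]; last first.
  by rewrite size_map [in ltnRHS]pE size_scale// size_prod_XsubC.
have rE : \prod_(x <- r) ('X - x%:P) = (\prod_(x <- r) - x) *: inv_root_poly [seq x^-1 | x <- r].
  rewrite /inv_root_poly big_map; elim: r r0 {pE} => [|x r IH]; first by rewrite !big_nil scale1r.
  rewrite inE negb_or => /andP[x0 r0]; rewrite !big_cons IH// [- x * _]mulrC -scalerA -scalerAr; congr (_ *: _).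
  rewrite -mul_polyC mulrA; congr (_ * _); rewrite mulrBr mulr1.
  by rewrite !mulrA -polyCM mulNr mulfV 1?eq_sym// !polyCN mulNr mul1r opprK addrC.
have := p0; rewrite pE rE scalerA coefZ inv_root_poly0 mulr1 => ->.
by rewrite scale1r.
Qed.

Lemma sum_sqr_le (I : Type) (s : seq I) (a : I -> R) : (forall i, 0 <= a i) ->
  \sum_(i <- s) a i ^+ 2 <= (\sum_(i <- s) a i) ^+ 2.
Proof.
move=> a0; elim: s => [|i s IH]; first by rewrite !big_nil expr0n.
rewrite !big_cons; have := a0 i; have : 0 <= \sum_(j <- s) a j by rewrite sumr_ge0.
by move: IH; set x := \sum_(j <- s) _; set y := \sum_(j <- s) _; nra.
Qed.

(** The reciprocal roots are sorted by decreasing modulus, so that the product of the first [j + 1]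
    moduli bounds [|u_j|^(j+1)]; this gives decay in [j] with a constant independent of [N]. *)
Lemma truncated_factorization (c : nat -> R[i]) (M T : R) N :
  c 0%N = 1 -> 0 <= T ->
  (forall n, normc (c n) <= M * (T ^+ n / n`!%:R)) ->
  exists u : nat -> R[i],
    [/\ forall j, normc (u j) <= M * expR T / j.+1%:R,
        forall z, \sum_(0 <= n < N.+2) c n * z ^+ n = \prod_(0 <= j < N.+1) (1 - u j * z)
      & \sum_(0 <= j < N.+1) u j = - c 1%N].
Proof.
move=> c0 T0 cM.
have M1 : 1 <= M by have := cM 0%N; rewrite c0 normc1 expr0 divr1 mulr1.
pose p := \poly_(n < N.+2) c n.
have p0 : p`_0 = 1 by rewrite coef_poly.
have [U0 pE0 sU0] := inv_root_factorization p0.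
pose geN (x y : R[i]) := normc y <= normc x.
have geN_tr : transitive geN by move=> x y z; rewrite /geN => h1 h2; exact: le_trans h1.
have geN_tot : total geN by move=> x y; exact: le_total.
pose U := sort geN U0.
have pE : p = inv_root_poly U by rewrite pE0; apply: perm_big; rewrite perm_sym perm_sort.
have sU : (size U <= N.+1)%N.
  rewrite size_sort -ltnS (leq_trans sU0)//; exact: size_poly.
(* Past the end of [U], [nth] returns 0, at which [f] is the neutral element; the list thus becomes
   a sequence of fixed length [N + 1]. *)
have extend (V : Type) (id : V) (op : Monoid.com_law id) (f : R[i] -> V) : f 0 = id ->
    \big[op/id]_(u <- U) f u = \big[op/id]_(0 <= j < N.+1) f (nth 0 U j).
  move=> f0; rewrite (big_nth 0) [RHS](big_cat_nat (n := size U))//=.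
  rewrite [X in _ = op _ X]big_nat [X in _ = op _ X]big1 ?Monoid.mulm1//.
  by move=> j /andP[jU _]; rewrite nth_default.
exists (fun j => nth 0 U j); split; last 2 first.
- move=> z; rewrite -(extend _ _ _ (fun u => 1 - u * z)) ?mul0r ?subr0//.
  by rewrite -horner_inv_root_poly -pE horner_poly big_mkord.
- rewrite -(extend _ _ _ id)// -[LHS]opprK -inv_root_poly_coef1 -pE.
  by rewrite coef_poly.
move=> j; have [Uj|jU] := leqP (size U) j.
  rewrite nth_default// normc0 divr_ge0// mulr_ge0 ?expR_ge0//; exact: le_trans M1.
have j1 : 0 < j.+1%:R :> R by rewrite ltr0n.
rewrite ler_pdivlMr//.
rewrite -(@ler_pXn2r _ j.+1)// ?nnegrE ?mulr_ge0 ?normc_ge0 ?expR_ge0//; last exact: le_trans M1.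
(* Landau's inequality for the [j + 1] largest [u]'s on the circle of radius [j + 1]. *)
pose r : R := j.+1%:R; pose rc : R[i] := j.+1%:R.
have nrc : normc rc = r by rewrite normc_nat.
pose V := [seq rc * u | u <- U].
have nV i : (i < N.+3)%N -> normc (inv_root_poly V)`_i <= M * ((T * r) ^+ i / i`!%:R).
  move=> iN; rewrite coef_inv_root_poly_scale -pE normcM normcX nrc coef_poly.
  rewrite exprMn mulrC; case: ifP => _.
    rewrite (_ : M * _ = M * (T ^+ i / i`!%:R) * r ^+ i); last by ring.
    by rewrite ler_wpM2r// exprn_ge0.
  by rewrite normc0 mul0r mulr_ge0// ?(le_trans _ M1)// divr_ge0// mulr_ge0// exprn_ge0.
have MrT : 0 <= M * expR (T * r) by rewrite mulr_ge0 ?expR_ge0// (le_trans _ M1).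
have Vle : sqnorm_coef N.+3 (inv_root_poly V) <= (M * expR (T * r)) ^+ 2.
  apply: le_trans (sum_sqr_le _ _) _ => [i|]; first exact: normc_ge0.
  rewrite ler_pXn2r// ?nnegrE ?sumr_ge0//; last by move=> i _; exact: normc_ge0.
  have Tr : 0 <= T * r by rewrite mulr_ge0.
  apply: (@le_trans _ _ (M * \sum_(0 <= i < N.+3) (T * r) ^+ i / i`!%:R)).
    rewrite mulr_sumr big_nat [leRHS]big_nat; apply: ler_sum => i /andP[_ iN]; exact: nV.
  by rewrite ler_wpM2l ?expR_partial_sum_le// (le_trans _ M1).
have sV : size V = size U by rewrite size_map.
have Ple : \prod_(u <- take j.+1 V) normc u <= M * expR (T * r).
  rewrite -(@ler_pXn2r _ 2)// ?nnegrE ?prodr_ge0//; last by move=> ? _; exact: normc_ge0.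
  apply: le_trans Vle; rewrite -prodrXl -{2}(cat_take_drop j.+1 V).
  by apply: landau_inequality; rewrite -size_cat cat_take_drop sV ltnS (leq_trans sU).
(* As the moduli decrease, each of the first [j + 1] factors is at least [(j + 1) |u_j|]. *)
apply: (@le_trans _ _ (\prod_(u <- take j.+1 V) normc u)).
  rewrite (big_nth 0) size_takel ?sV// mulrC.
  rewrite -[X in _ ^+ X]subn0 -prodr_const_nat big_nat [leRHS]big_nat.
  apply: ler_prod => i /andP[_ ij].
  rewrite mulr_ge0 ?normc_ge0//= nth_take// (nth_map 0) ?(leq_trans ij)// normcM nrc.
  rewrite ler_wpM2l// -[_ <= _]/(geN _ _).
  apply: (sorted_leq_nth geN_tr) => //; rewrite ?inE//.
  - by move=> x; exact: lexx.
  - exact: sort_sorted.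
  - exact: leq_ltn_trans jU.
(* With [r = j + 1] the bound is [M (e^T)^(j+1)], at most the required [(M e^T)^(j+1)] since
   [1 <= M]. *)
apply: le_trans Ple _.
rewrite expRM_natr exprMn ler_wpM2r ?exprn_ge0 ?expR_ge0//.
by rewrite ler_eXnr.
Qed.

End LandauInequality.

(** * Canonical products of genus one *)

Section UltrafilterLimits.
Context {R : realType} {T : Type} {G : set_system T} {GU : UltraFilter G}.

Lemma ultra_fmap (U : Type) (f : T -> U) : UltraFilter (f @ G).
Proof.
split; first exact: fmap_proper_filter.
move=> H HF sub; apply/seteqP; split=> [A HA|]; last exact: sub.
have [//|GnA] := in_ultra_setVsetC (f @^-1` A) GU.
have /filter_ex[x []//] : H (A `&` ~` A) by apply: filterI => //; exact: sub.
Qed.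

Lemma ultra_bounded_cvg (f : T -> R) (a : R) :
  (forall x, `|f x| <= a) -> exists l : R, f x @[x --> G] --> l.
Proof.
move=> fa; have Ga : G (f @^-1` `[- a, a]).
  by apply: filterE => t /=; rewrite in_itv/= -ler_norml.
have := @segment_compact R (- a) a.
by rewrite compact_ultra => /(_ (f @ G) (ultra_fmap f) Ga) [l [_ fl]]; exists l.
Qed.

(** Since every bounded family converges along a given ultrafilter, one ultrafilter serves all
    indices [j] at once and no diagonal extraction is needed. *)
Lemma ultra_bounded_ccvg (f : T -> R[i]) (a : R) :
  (forall x, normc (f x) <= a) -> exists l, ccvg G f l.
Proof.
move=> fa.
have [x fx] := @ultra_bounded_cvg (fun t => complex.Re (f t)) a
  (fun t => le_trans (Re_le_normc _) (fa t)).
have [y fy] := @ultra_bounded_cvg (fun t => complex.Im (f t)) a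
  (fun t => le_trans (Im_le_normc _) (fa t)).
by exists (x +i* y); apply: ccvg_ReIm.
Qed.

End UltrafilterLimits.

Section CanonicalProducts.
Context {R : realType}.
Implicit Types (u : nat -> R[i]) (z : R[i]) (K r : R).

Lemma ccvg_cexp (T : Type) (F : set_system T) (FF : ProperFilter F) (w : T -> R[i]) l :
  ccvg F w l -> ccvg F (fun x => cexp (w x)) (cexp l).
Proof.
move=> wl; apply: (@ccvg_squeeze _ _ _ _ _ _ (fun x => normc (cexp l) * (normc (w x - l) * expR (normc (w x - l))))).
  near=> x; rewrite -{1}(subrK l (w x)) cexpD -{2}(mul1r (cexp l)) -mulrBl normcM mulrC.
  by rewrite ler_wpM2l ?normc_ge0// normc_cexp_sub1.
have -> : (0 : R) = normc (cexp l) * (0 * expR 0) by rewrite mul0r mulr0.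
apply: cvgM; first exact: cvg_cst.
apply: cvgM; first exact: wl.
by apply: continuous_cvg => //; exact: continuous_expR.
Unshelve. all: end_near. Qed.

Lemma ccvg_efactor (T : Type) (F : set_system T) (FF : ProperFilter F) (w : T -> R[i]) l :
  ccvg F w l -> ccvg F (fun x => efactor (w x)) (efactor l).
Proof.
by move=> wl; apply: ccvgM (ccvg_cexp _ wl); exact: ccvgB (ccvg_cst _) wl.
Qed.

(** As [j + 2 <= 2 (j + 1)], each term is at most [2 / (j + 1) - 2 / (j + 2)], and these telescope
    over an interval containing [S]. Arbitrary finite index sets are allowed with rearrangements in
    view. *)
Lemma sum_inv_sqr_le (S : seq nat) n : uniq S -> all (leq n) S ->
  \sum_(j <- S) (j.+1%:R ^- 2 : R) <= 2 / n.+1%:R.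
Proof.
move=> uS nS; pose m := (n + \max_(j <- S) j.+1)%N.
have mS j : j \in S -> (n <= j < m)%N.
  move=> jS; rewrite (allP nS _ jS)/= /m ltn_addl//.
  by rewrite (big_rem j)//= leq_maxl.
apply: (@le_trans _ _ (\sum_(n <= j < m) (2 / j.+1%:R - 2 / j.+2%:R : R))).
  rewrite (perm_big [seq j <- index_iota n m | j \in S]); last first.
    apply: uniq_perm; rewrite ?filter_uniq ?iota_uniq// => j.
    rewrite mem_filter mem_index_iota; case: (boolP (j \in S)) => //= jS.
    by rewrite mS.
  rewrite big_filter big_mkcond; apply: ler_sum => j _.
  have j1 : 0 < j.+1%:R :> R by rewrite ltr0n.
  have j2 : j.+2%:R = j.+1%:R + 1 :> R by rewrite -natr1.
  have -> : 2 / j.+1%:R - 2 / j.+2%:R = 2 / (j.+1%:R * j.+2%:R) :> R.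
    by rewrite j2; field; rewrite !gt_eqF// addr_gt0.
  case: ifP => _; last by rewrite divr_ge0// mulr_ge0.
  rewrite j2 ler_pdivlMr ?mulr_gt0 ?addr_gt0//.
  have -> : j.+1%:R ^- 2 * (j.+1%:R * (j.+1%:R + 1)) = (j.+1%:R + 1) / j.+1%:R :> R.
    by field; rewrite gt_eqF.
  rewrite ler_pdivrMr//; have : 1 <= j.+1%:R :> R by rewrite ler1n.
  by lra.
rewrite (eq_bigr (fun j => - (2 / j.+2%:R) - - (2 / j.+1%:R))); last first.
  by move=> j _; rewrite opprK addrC.
rewrite telescope_sumr ?leq_addr// opprK addrC gerBl.
by rewrite divr_ge0.
Qed.

(* Bounds [|prod_(j in S) E(u_j z) - 1|] for finite [S] in [[n, oo[] when
   [|u_j| <= K / (j + 1)] and [|z| = r]. *)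
Definition tail_bound K r n : R :=
  expR (4 * (K * r) ^+ 2 * expR (K * r) / n.+1%:R) - 1.

Lemma tail_bound_ge0 K r n : 0 <= tail_bound K r n.
Proof.
rewrite subr_ge0 -expR0 ler_expR divr_ge0// mulr_ge0 ?expR_ge0// mulr_ge0//.
exact: sqr_ge0.
Qed.

Lemma cvg_tail_bound K r : tail_bound K r n @[n --> \oo] --> (0 : R).
Proof.
have -> : (0 : R) = expR (4 * (K * r) ^+ 2 * expR (K * r) * 0) - 1.
  by rewrite mulr0 expR0 subrr.
apply: cvgB; last exact: cvg_cst.
apply: continuous_cvg; first exact: continuous_expR.
by apply: cvgM; [exact: cvg_cst | exact: cvg_harmonic].
Qed.

Lemma tail_bound_mono K r r' n m : 0 <= K -> 0 <= r -> r <= r' -> (n <= m)%N ->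
  tail_bound K r m <= tail_bound K r' n.
Proof.
move=> K0 r0 rr nm; have r'0 := le_trans r0 rr.
have Krr : K * r <= K * r' by rewrite ler_wpM2l.
rewrite lerD2r ler_expR; apply: ler_pM; rewrite ?invr_ge0//.
- by rewrite mulr_ge0 ?expR_ge0// mulr_ge0// sqr_ge0.
- apply: ler_pM; rewrite ?expR_ge0 ?ler_expR//; first by rewrite mulr_ge0// sqr_ge0.
  by rewrite ler_wpM2l// lerXn2r// nnegrE mulr_ge0.
- by rewrite lef_pV2 ?posrE ?ltr0n// ler_nat.
Qed.

(** The factor at [j] differs from 1 by at most a constant times [(j + 1)^-2], and the tails of that
    series are of order [1 / (n + 1)]. *)
Lemma normc_prod_efactor_sub1 u K z (S : seq nat) n :
  (forall j, normc (u j) <= K / j.+1%:R) -> uniq S -> all (leq n) S ->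
  normc (\prod_(j <- S) efactor (u j * z) - 1) <= tail_bound K (normc z) n.
Proof.
move=> uK uS nS; apply: le_trans (normc_prod_sub1 _ _ _) _.
have z0 := normc_ge0 z.
have K0 : 0 <= K by have := le_trans (normc_ge0 _) (uK 0%N); rewrite divr1.
set r := normc z in z0 *; rewrite lerD2r ler_expR.
apply: (@le_trans _ _ (\sum_(j <- S) (2 * ((K * r) ^+ 2 * expR (K * r)) * j.+1%:R ^- 2))).
  apply: ler_sum => j _; apply: le_trans (normc_efactor_sub1 _) _.
  rewrite -[leRHS]mulrA ler_wpM2l// [leRHS]mulrAC normcM -/r.
  have uj : normc (u j) * r <= K * r / j.+1%:R by rewrite mulrAC ler_wpM2r.
  have uj0 : 0 <= normc (u j) * r by rewrite mulr_ge0// normc_ge0.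
  apply: ler_pM; rewrite ?sqr_ge0 ?expR_ge0//.
    by rewrite -exprVn -exprMn lerXn2r// nnegrE (le_trans uj0).
  rewrite ler_expR (le_trans uj)// ler_pdivrMr ?ltr0n// ler_peMr ?mulr_ge0//.
  by rewrite ler1n.
rewrite -mulr_sumr.
have := sum_inv_sqr_le uS nS; set s := \sum_(j <- S) _ => sle.
have c0 : 0 <= 2 * ((K * r) ^+ 2 * expR (K * r)).
  by rewrite mulr_ge0// mulr_ge0 ?expR_ge0 ?sqr_ge0.
apply: le_trans (ler_wpM2l c0 sle) _; rewrite le_eqVlt; apply/orP; left; apply/eqP; ring.
Qed.

(** Indexed by the reciprocals of the zeros, so that [u j = 0] encodes a missing zero: its factor is
    1. *)
Definition canonical_prod u n z := \prod_(0 <= j < n) efactor (u j * z).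

Lemma canonical_prod_dist u K z n m :
  (forall j, normc (u j) <= K / j.+1%:R) -> (n <= m)%N ->
  normc (canonical_prod u m z - canonical_prod u n z) <=
  normc (canonical_prod u n z) * tail_bound K (normc z) n.
Proof.
move=> uK nm; rewrite /canonical_prod (big_cat_nat _ nm)//=.
rewrite -[X in _ - X]mulr1 -mulrBr normcM ler_wpM2l ?normc_ge0//.
apply: normc_prod_efactor_sub1 => //; first exact: iota_uniq.
by apply/allP => j; rewrite mem_index_iota => /andP[].
Qed.

Lemma normc_canonical_prod_le u K z n :
  (forall j, normc (u j) <= K / j.+1%:R) ->
  normc (canonical_prod u n z) <= 1 + tail_bound K (normc z) 0.
Proof.
move=> uK; rewrite -[X in normc X](subrK 1) addrC.
apply: le_trans (le_normcD _ _) _; rewrite normc1 lerD2l.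
apply: normc_prod_efactor_sub1 => //; first exact: iota_uniq.
by apply/allP.
Qed.

(* The reciprocal roots of the Taylor polynomials are bounded uniformly by
   [K / (j + 1)], hence converge along an ultrafilter, and the canonical
   products converge with them. *)
Lemma hadamard_factorization (c : nat -> R[i]) (F : R[i] -> R[i]) (M T : R) :
  c 0%N = 1 -> 0 <= T -> (forall n, normc (c n) <= M * (T ^+ n / n`!%:R)) ->
  (forall z, ccvg \oo (fun n => \sum_(0 <= k < n) c k * z ^+ k) (F z)) ->
  exists u : nat -> R[i], exists2 K : R,
    (forall j, normc (u j) <= K / j.+1%:R) &
    forall z, ccvg \oo (fun n => canonical_prod u n z) (F z * cexp (- (c 1%N * z))).
Proof.
move=> c0 T0 cM cF.
have [v vP] := choice (fun N => truncated_factorization N c0 T0 cM).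
set K := M * expR T in vP.
have vK N j : normc (v N j) <= K / j.+1%:R by have [+ _ _] := vP N; exact.
(* An ultrafilter finer than [\oo]: limits along [\oo] persist, and bounded sequences converge. *)
have [G [GU sG]] := @ultraFilterLemma nat \oo _.
have GP : ProperFilter G := ultra_proper.
have [u uP] := choice (fun j => ultra_bounded_ccvg (fun N => vK N j)).
have uK j : normc (u j) <= K / j.+1%:R.
  by apply: (ccvg_le (uP j)); exact: filterE.
exists u, K => // z.
pose S N := \sum_(0 <= k < N) c k * z ^+ k.
(* The reciprocal roots sum to [- c 1], so [e^(- c_1 z)] supplies exactly the exponential parts of
   the factors. *)
have SE N : S N.+2 * cexp (- (c 1%N * z)) = canonical_prod (v N) N.+1 z.
  have [_ vprod vsum] := vP N.
  rewrite /S vprod /canonical_prod -mulNr -vsum mulr_suml cexp_sum -big_split/=.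
  by apply: eq_bigr.
have SG : ccvg G (fun N => S N.+2) (F z).
  have := cF z; rewrite /ccvg -(cvg_shiftn 2) => h.
  apply: cvg_trans h => A /=; rewrite /fmap/= /nbhs/= => h.
  by apply: sG; move: h; under eq_fun do rewrite addn2.
(* The tail estimate is uniform in the degree [N] and passes to the limit along [G]; the result no
   longer mentions [G] and gives ordinary convergence in [n]. *)
have key n : normc (F z * cexp (- (c 1%N * z)) - canonical_prod u n z) <=
    normc (canonical_prod u n z) * tail_bound K (normc z) n.
  have cp : ccvg G (fun N => canonical_prod (v N) n z) (canonical_prod u n z).
    apply: ccvg_prod => j; apply: ccvg_efactor.
    by apply: ccvgM; [exact: uP | exact: ccvg_cst].
  have lhs := ccvg_norm (ccvgB (ccvgM SG (ccvg_cst (cexp (- (c 1%N * z))))) cp).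
  have rhs := cvgM (ccvg_norm cp) (cvg_cst (tail_bound K (normc z) n)).
  apply: (ler_cvg_to (lhs _ _ _ _) (rhs _ _ _)).
  apply: sG; exists n => // N /= nN; rewrite SE.
  by apply: canonical_prod_dist => //; exact: leqW.
apply: (@ccvg_squeeze _ _ _ _ _ _ (fun n => (1 + tail_bound K (normc z) 0) * tail_bound K (normc z) n)).
  apply: filterE => n; rewrite normc_distC (le_trans (key n))//.
  by rewrite ler_wpM2r ?tail_bound_ge0// normc_canonical_prod_le.
rewrite -[X in _ --> X](mulr0 (1 + tail_bound K (normc z) 0)).
by apply: cvgM; [exact: cvg_cst | exact: cvg_tail_bound].
Qed.

End CanonicalProducts.

(** * Integration of complex-valued functions *)

Section ComplexMeasurability.
Context {R : realType} d {T : measurableType d}.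
Implicit Types (f g : T -> R[i]).

Definition cmeasurable f :=
  measurable_fun setT (fun t => complex.Re (f t)) /\
  measurable_fun setT (fun t => complex.Im (f t)).

Lemma cmeasurable_cst (z : R[i]) : cmeasurable (fun=> z).
Proof. by split; exact: measurable_cst. Qed.

Lemma cmeasurable_real (r : T -> R) : measurable_fun setT r -> cmeasurable (fun t => (r t)%:C).
Proof. by move=> mr; split => //; exact: measurable_cst. Qed.

Lemma cmeasurable_imag (r : T -> R) : measurable_fun setT r -> cmeasurable (fun t => 0 +i* r t).
Proof. by move=> mr; split => //; exact: measurable_cst. Qed.

Lemma cmeasurableM f g : cmeasurable f -> cmeasurable g -> cmeasurable (fun t => f t * g t).
Proof.
move=> [rf jf] [rg jg]; split.
  rewrite (_ : (fun t => _) = (fun t => complex.Re (f t) * complex.Re (g t) -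
      complex.Im (f t) * complex.Im (g t))).
    by apply: measurable_funB; exact: measurable_funM.
  by apply/funext => t; case: (f t) => a b; case: (g t).
rewrite (_ : (fun t => _) = (fun t => complex.Re (f t) * complex.Im (g t) +
    complex.Im (f t) * complex.Re (g t))).
  by apply: measurable_funD; exact: measurable_funM.
by apply/funext => t; case: (f t) => a b; case: (g t).
Qed.

Lemma cmeasurableX f n : cmeasurable f -> cmeasurable (fun t => f t ^+ n).
Proof.
move=> mf; elim: n => [|n IH]; first exact: cmeasurable_cst.
by under eq_fun do rewrite exprS; exact: cmeasurableM.
Qed.

Lemma cmeasurable_conj f : cmeasurable f -> cmeasurable (fun t => (f t)^*).
Proof.
move=> [rf jf]; split.
  rewrite (_ : (fun t => _) = (fun t => complex.Re (f t)))//.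
  by apply/funext => t; case: (f t).
rewrite (_ : (fun t => _) = (fun t => - complex.Im (f t))).
  exact: measurable_funN.
by apply/funext => t; case: (f t).
Qed.

Lemma cmeasurable_cexp f : cmeasurable f -> cmeasurable (fun t => cexp (f t)).
Proof.
move=> [rf jf]; apply: cmeasurableM.
  apply: cmeasurable_real; apply: (measurableT_comp _ rf).
  by apply: continuous_measurable_fun; exact: continuous_expR.
split; apply: (measurableT_comp _ jf); apply: continuous_measurable_fun.
  exact: continuous_cos.
exact: continuous_sin.
Qed.

Lemma measurable_normc f : cmeasurable f -> measurable_fun setT (fun t => normc (f t)).
Proof.
move=> [rf jf]; rewrite (_ : (fun t => _) =
  (fun t => Num.sqrt (complex.Re (f t) ^+ 2 + complex.Im (f t) ^+ 2))); last first.
  by apply/funext => t; case: (f t).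
apply: (@measurableT_comp _ _ _ _ _ _ (@Num.sqrt R)).
  by apply: continuous_measurable_fun; exact: sqrt_continuous.
by apply: measurable_funD; exact: measurable_funX.
Qed.

End ComplexMeasurability.

Section ComplexIntegral.
Context {R : realType}.
Local Notation mu := (@lebesgue_measure R).
Implicit Types (f g h : R -> R[i]) (z : R[i]) (k : R -> R).

(* [filterS] on the carrier [measurableTypeR R] of [lebesgue_measure], where the
   filter instance is not inferred. *)
Lemma ae_imply (P Q : R -> Prop) : (forall t, P t -> Q t) ->
  {ae mu, forall t, P t} -> {ae mu, forall t, Q t}.
Proof.
move=> PQ; apply: (@filterS _ _ (ae_filter_ringOfSetsType mu)).
exact: PQ.
Qed.

Definition cintegrable f :=
  mu.-integrable setT (EFin \o (fun t => complex.Re (f t))) /\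
  mu.-integrable setT (EFin \o (fun t => complex.Im (f t))).

Lemma le_cintegrable f k : cmeasurable f -> (forall t, normc (f t) <= k t) ->
  mu.-integrable setT (EFin \o k) -> cintegrable f.
Proof.
move=> [rf jf] fk ik; split.
  apply: le_integrable ik => //; first exact/measurable_EFinP.
  move=> t _ /=; rewrite lee_fin (le_trans (Re_le_normc _))// (le_trans (fk _))//.
  exact: ler_norm.
apply: le_integrable ik => //; first exact/measurable_EFinP.
move=> t _ /=; rewrite lee_fin (le_trans (Im_le_normc _))// (le_trans (fk _))//.
exact: ler_norm.
Qed.

Lemma eq_Cintegral f g : f =1 g -> Cintegral f = Cintegral g.
Proof. by move=> /funext ->. Qed.

Lemma CintegralD f g : cintegrable f -> cintegrable g ->
  Cintegral (fun t => f t + g t) = Cintegral f + Cintegral g.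
Proof.
move=> [rf jf] [rg jg]; rewrite /Cintegral; simpc; congr (_ +i* _).
  rewrite -RintegralD//; apply: eq_Rintegral => t _.
  by case: (f t) => a b; case: (g t).
rewrite -RintegralD//; apply: eq_Rintegral => t _.
by case: (f t) => a b; case: (g t).
Qed.

Lemma cintegrableD f g : cintegrable f -> cintegrable g -> cintegrable (fun t => f t + g t).
Proof.
move=> [rf jf] [rg jg]; split.
  apply: eq_integrable (integrableD measurableT rf rg) => // t _ /=.
  by case: (f t) => a b; case: (g t).
apply: eq_integrable (integrableD measurableT jf jg) => // t _ /=.
by case: (f t) => a b; case: (g t).
Qed.

Lemma cintegrable0 : cintegrable (fun=> 0).
Proof. by split; exact: integrable0. Qed.

Lemma CintegralZl z f : cintegrable f -> Cintegral (fun t => z * f t) = z * Cintegral f.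
Proof.
case: z => a b [rf jf]; rewrite /Cintegral; simpc; congr (_ +i* _).
  rewrite -!RintegralZl// -RintegralB//; last 2 first.
  - by apply: eq_integrable (integrableZl measurableT a rf).
  - by apply: eq_integrable (integrableZl measurableT b jf).
  by apply: eq_Rintegral => t _; case: (f t).
rewrite -!RintegralZl// -RintegralD//; last 2 first.
- by apply: eq_integrable (integrableZl measurableT a jf).
- by apply: eq_integrable (integrableZl measurableT b rf).
by apply: eq_Rintegral => t _; case: (f t).
Qed.

Lemma cintegrableZl z f : cintegrable f -> cintegrable (fun t => z * f t).
Proof.
case: z => a b [rf jf]; split.
  apply: eq_integrable (integrableB measurableT (integrableZl measurableT a rf) (integrableZl measurableT b jf)) => // t _ /=.
  by case: (f t).
apply: eq_integrable (integrableD measurableT (integrableZl measurableT a jf) (integrableZl measurableT b rf)) => // t _ /=.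
by case: (f t).
Qed.

Lemma Cintegral_conj f : cintegrable f -> Cintegral (fun t => (f t)^*) = (Cintegral f)^*.
Proof.
move=> [rf jf]; rewrite /Cintegral; simpc; congr (_ +i* _).
  by apply: eq_Rintegral => t _; case: (f t).
rewrite -mulN1r -RintegralZl//.
by apply: eq_Rintegral => t _; case: (f t) => a b /=; rewrite mulN1r.
Qed.

Lemma CintegralB f g : cintegrable f -> cintegrable g ->
  Cintegral (fun t => f t - g t) = Cintegral f - Cintegral g.
Proof.
move=> fi gi; have ng := cintegrableZl (- 1) gi.
rewrite (eq_Cintegral (g := fun t => f t + - 1 * g t)); last by move=> t; rewrite mulN1r.
by rewrite CintegralD// CintegralZl// mulN1r.
Qed.

Lemma Cintegral_sum (F : nat -> R -> R[i]) n : (forall j, cintegrable (F j)) ->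
  cintegrable (fun t => \sum_(0 <= j < n) F j t) /\
  Cintegral (fun t => \sum_(0 <= j < n) F j t) = \sum_(0 <= j < n) Cintegral (F j).
Proof.
move=> Fi; elim: n => [|n [IHi IH]].
  rewrite big_nil (_ : (fun t => _) = fun=> 0); last first.
    by apply/funext => t; rewrite big_nil.
  split; first exact: cintegrable0.
  by rewrite /Cintegral /= /Rintegral !integral0.
rewrite (_ : (fun t => _) = (fun t => \sum_(0 <= j < n) F j t + F n t)); last first.
  by apply/funext => t; rewrite big_nat_recr.
split; first exact: cintegrableD.
by rewrite CintegralD// IH big_nat_recr.
Qed.

(** The factor 2 comes from estimating the real and imaginary parts separately. *)
Lemma normc_Cintegral_le f k : cintegrable f -> mu.-integrable setT (EFin \o k) ->
  (forall t, 0 <= k t) -> {ae mu, forall t, normc (f t) <= k t} ->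
  normc (Cintegral f) <= 2 * Rintegral mu setT k.
Proof.
move=> [rf jf] ik k0 fk; apply: le_trans (normc_le_ReIm _) _ => /=.
have aux (r : R -> R) : mu.-integrable setT (EFin \o r) ->
    (forall t, `|r t| <= normc (f t)) ->
    `|Rintegral mu setT r| <= Rintegral mu setT k.
  move=> ir rle; apply: le_trans (le_normr_Rintegral _ _) _ => //.
  have inr := integrable_norm ir.
  rewrite /Rintegral fine_le//.
  - exact: integrable_fin_num inr.
  - exact: integrable_fin_num ik.
  have /integrableP[mnr _] := inr; have /integrableP[mk _] := ik.
  apply: (ae_ge0_le_integral measurableT _ mnr _ mk).
  - by move=> t _; rewrite /= lee_fin normr_ge0.
  - by move=> t _; rewrite /= lee_fin k0.
  by move: fk; apply: ae_imply => t fkt _; rewrite lee_fin; exact: le_trans (rle t) fkt.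
have e2 (x : R) : 2 * x = x + x by ring.
rewrite e2; apply: lerD; apply: aux => // t; first exact: Re_le_normc.
exact: Im_le_normc.
Qed.

(** Lebesgue measure is determined by its values on half-open intervals, where invariance is a
    computation. *)
Lemma lebesgue_measure_shift (s : R) (A : set R) : measurable A ->
  pushforward mu ((fun t => s + t) : _ -> measurableTypeR R) A = mu A.
Proof.
move=> mA.
have ms : measurable_fun setT ((fun t => s + t) : measurableTypeR R -> measurableTypeR R).
  by apply: (measurable_funD (measurable_cst _)); exact: measurable_id.
apply/esym/lebesgue_measure_unique => // _ [[a b]] _ <-.
have E : `]a - s, b - s]%classic = (fun t => s + t) @^-1` `]a, b]%classic.
  by apply/seteqP; split => t /=; rewrite !in_itv/= ltrBlDl lerBrDl.
apply: etrans (congr1 mu E).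
rewrite !lebesgue_measure_itv/= !lte_fin ltrD2r; case: ifPn => // _.
by rewrite -!EFinB opprD opprK addrACA addNr addr0.
Qed.

Lemma ge0_integral_shift (s : R) (k : R -> \bar R) :
  measurable_fun setT k -> (forall t, 0 <= k t)%E ->
  (\int[mu]_t k (s + t)%R = \int[mu]_t k t)%E.
Proof.
move=> mk k0.
have ms : measurable_fun setT ((fun t => s + t) : measurableTypeR R -> measurableTypeR R).
  by apply: (measurable_funD (measurable_cst _)); exact: measurable_id.
transitivity (\int[pushforward mu ((fun t => s + t)%R : _ -> measurableTypeR R)]_t k t)%E.
  by rewrite ge0_integral_pushforward.
by apply: eq_measure_integral => A mA _; exact: lebesgue_measure_shift.
Qed.

Lemma integrable_shift (s : R) (k : R -> R) : mu.-integrable setT (EFin \o k) ->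
  mu.-integrable setT (EFin \o (fun t => k (s + t))).
Proof.
move=> /integrableP[mk klty].
have ms : measurable_fun setT ((fun t => s + t) : measurableTypeR R -> measurableTypeR R).
  by apply: (measurable_funD (measurable_cst _)); exact: measurable_id.
apply/integrableP; split; first exact: (measurableT_comp mk ms).
apply: le_lt_trans klty.
rewrite -(@ge0_integral_shift s (fun t => `|(k t)%:E|%E))//.
exact: measurableT_comp.
Qed.

Lemma Rintegral_shift (s : R) (k : R -> R) : mu.-integrable setT (EFin \o k) ->
  Rintegral mu setT (fun t => k (s + t)) = Rintegral mu setT k.
Proof.
move=> ik; have /integrableP[mk _] := ik.
have ms : measurable_fun setT ((fun t => s + t) : measurableTypeR R -> measurableTypeR R).
  by apply: (measurable_funD (measurable_cst _)); exact: measurable_id.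
rewrite /Rintegral; congr fine.
transitivity (\int[pushforward mu ((fun t => s + t)%R : _ -> measurableTypeR R)]_t (k t)%:E)%E.
  by rewrite (integral_pushforward ms mk)//; exact: integrable_shift.
by apply: eq_measure_integral => A mA _; exact: lebesgue_measure_shift.
Qed.

Lemma cintegrable_shift (s : R) f : cintegrable f -> cintegrable (fun t => f (s + t)).
Proof.
by move=> [rf jf]; split; [exact: integrable_shift rf | exact: integrable_shift jf].
Qed.

Lemma Cintegral_shift (s : R) f : cintegrable f ->
  Cintegral (fun t => f (s + t)) = Cintegral f.
Proof.
move=> [rf jf]; rewrite /Cintegral.
by rewrite (Rintegral_shift s rf) (Rintegral_shift s jf).
Qed.

Lemma Rintegral_Fubini (k : R * R -> R) :
  (mu \x mu)%E.-integrable setT (EFin \o k) ->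
  Rintegral mu setT (fun x => Rintegral mu setT (fun y => k (x, y))) =
  Rintegral mu setT (fun y => Rintegral mu setT (fun x => k (x, y))).
Proof.
move=> ik; rewrite /Rintegral; congr fine.
(* The inner real integral is the [fine] part of the extended one; they agree for almost every [x],
   where the section is integrable. *)
transitivity (\int[mu]_x \int[mu]_y (k (x, y))%:E)%E.
  have mF := measurable_fubini_F ik.
  apply: ae_eq_integral => //.
    by apply/measurable_EFinP; apply: measurableT_comp => //; exact: fine_measurable.
  have := ae_integrable1 ik; apply: ae_imply => x ix _.
  by rewrite fineK//; exact: integrable_fin_num ix.
rewrite (Fubini ik); have mG := measurable_fubini_G ik.
apply: ae_eq_integral => //.
  by apply/measurable_EFinP; apply: measurableT_comp => //; exact: fine_measurable.
have := ae_integrable2 ik; apply: ae_imply => x ix _.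
by rewrite fineK//; exact: integrable_fin_num ix.
Qed.

Lemma Cintegral_Fubini (F : R * R -> R[i]) (k : R * R -> R) :
  cmeasurable F -> (forall p, normc (F p) <= k p) ->
  (mu \x mu)%E.-integrable setT (EFin \o k) ->
  Cintegral (fun x => Cintegral (fun y => F (x, y))) =
  Cintegral (fun y => Cintegral (fun x => F (x, y))).
Proof.
move=> [rF jF] Fk ik; rewrite /Cintegral/=; congr (_ +i* _).
  apply: (Rintegral_Fubini (k := fun p => complex.Re (F p))).
  apply: le_integrable ik => //; first exact/measurable_EFinP.
  move=> t _ /=; rewrite lee_fin (le_trans (Re_le_normc _))// (le_trans (Fk _))//.
  exact: ler_norm.
apply: (Rintegral_Fubini (k := fun p => complex.Im (F p))).
apply: le_integrable ik => //; first exact/measurable_EFinP.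
move=> t _ /=; rewrite lee_fin (le_trans (Im_le_normc _))// (le_trans (Fk _))//.
exact: ler_norm.
Qed.

End ComplexIntegral.

(** * Laplace transform, autocorrelation and linear canonical transform *)

Section LaplaceTransform.
Context {R : realType}.
Local Notation mu := (@lebesgue_measure R).
Implicit Types (f g h w : R -> R[i]) (z zeta : R[i]) (T : R).

(** Integrability against every exponential weight makes the Laplace integral converge at every
    point and supplies the majorant for Fubini. *)
Definition exp_integrable h :=
  cmeasurable h /\
  forall c : R, mu.-integrable setT (EFin \o (fun t => normc (h t) * expR (c * `|t|))).

Definition ess_support_le h T := {ae mu, forall t, T < `|t| -> h t = 0}.

Lemma measurable_expR_norm (c : R) : measurable_fun setT (fun t : R => expR (c * `|t|)).
Proof.
apply: (@measurableT_comp _ _ _ _ _ _ (@expR R)).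
  by apply: continuous_measurable_fun; exact: continuous_expR.
by apply: measurable_funM; [exact: measurable_cst | exact: normr_measurable].
Qed.

Lemma L2_compact_support_exp_integrable h : L2_compact_support h ->
  exp_integrable h /\ exists2 T, 0 <= T & ess_support_le h T.
Proof.
move=> [rh jh [K /compact_bounded [M [_ MK]] hK]].
have mh : cmeasurable h.
  by move: rh jh; rewrite !inE => /andP[/[!inE] + _] /andP[/[!inE] + _].
(* [M] may be negative, and [K] is bounded by every number exceeding [M]. *)
pose T := `|M| + 1.
have T0 : 0 <= T by rewrite addr_ge0.
have hT : ess_support_le h T.
  apply: ae_imply hK => t + Tt; apply => Kt.
  have MT : M < T by rewrite (le_lt_trans (ler_norm M))// ltrDl.
  by have /= := MK T MT t Kt; rewrite leNgt Tt.
split; last by exists T.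
split=> // c; pose k t := normc (h t) * expR (c * `|t|).
have mk : measurable_fun setT k.
  by apply: measurable_funM; [exact: measurable_normc | exact: measurable_expR_norm].
have k0 t : 0 <= k t by rewrite mulr_ge0 ?normc_ge0 ?expR_ge0.
pose i t : R := \1_(`[- T, T]%classic) t.
(* On [[-T, T]] this is [1 + |h|^2], which dominates [|h|]; it is integrable because [h] is in
   [L^2]. *)
pose m t := i t + (complex.Re (h t) ^+ 2 + complex.Im (h t) ^+ 2).
have im : mu.-integrable setT (EFin \o m).
  have i1 : mu.-integrable setT (EFin \o i) by exact: integrable_indic_itv.
  have i2 := Lfun2_integrable_sqr rh; have i3 := Lfun2_integrable_sqr jh.
  have := integrableD measurableT i1 (integrableD measurableT i2 i3).
  by apply: eq_integrable => // t _ /=.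
pose g t := expR (`|c| * T) * m t.
have ig : mu.-integrable setT (EFin \o g).
  by apply: eq_integrable (integrableZl measurableT (expR (`|c| * T)) im).
have m0 t : 0 <= m t.
  by rewrite addr_ge0 ?addr_ge0 ?sqr_ge0.
have g0 t : 0 <= g t by rewrite mulr_ge0 ?expR_ge0.
have /integrableP[mg goo] := ig.
apply/integrableP; split; first exact/measurable_EFinP.
apply: le_lt_trans goo; apply: ae_ge0_le_integral => //.
- by apply: measurableT_comp => //; exact/measurable_EFinP.
- exact/measurableT_comp.
apply: ae_imply hT => t ht _ /=; rewrite lee_fin (ger0_norm (k0 t)) (ger0_norm (g0 t)).
rewrite -[leLHS]/(normc (h t) * expR (c * `|t|)) [leLHS]mulrC -[leRHS]/(_ * m t).
have [tT|Tt] := leP `|t| T; last by rewrite (ht Tt) normc0 mulr0 mulr_ge0 ?expR_ge0.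
apply: ler_pM; rewrite ?normc_ge0 ?expR_ge0//.
  rewrite ler_expR (le_trans (ler_norm _))// normrM normr_id ler_wpM2l//.
have -> : m t = 1 + normc (h t) ^+ 2.
  by rewrite normc_sqr /m /i indicE mem_set//= in_itv/= -ler_norml.
by have := normc_ge0 (h t); nra.
Qed.

Lemma exp_integrableM w h (B : R) : cmeasurable w -> (forall t, normc (w t) = B) ->
  exp_integrable h -> exp_integrable (fun t => w t * h t).
Proof.
move=> mw wB [mh ih]; split; first exact: cmeasurableM.
move=> c; apply: eq_integrable (integrableZl measurableT B (ih c)) => // t _ /=.
by rewrite normcM wB -EFinM mulrA.
Qed.

Lemma cmeasurable_laplace_kernel zeta :
  cmeasurable (fun t : R => cexp (- (zeta * t%:C))).
Proof.
apply: cmeasurable_cexp; under eq_fun do rewrite -mulNr.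
apply: cmeasurableM; first exact: cmeasurable_cst.
by apply: cmeasurable_real; exact: measurable_id.
Qed.

Lemma normc_laplace_kernel zeta (t : R) :
  normc (cexp (- (zeta * t%:C))) <= expR (normc zeta * `|t|).
Proof. by rewrite (le_trans (normc_cexp_le _))// normcN normcM normc_real. Qed.

Lemma laplace_cintegrable h zeta : exp_integrable h ->
  cintegrable (fun t => h t * cexp (- (zeta * t%:C))).
Proof.
move=> [mh ih]; apply: le_cintegrable (ih (normc zeta)).
  by apply: cmeasurableM => //; exact: cmeasurable_laplace_kernel.
move=> t; rewrite normcM ler_wpM2l ?normc_ge0//; exact: normc_laplace_kernel.
Qed.

(** The Taylor coefficients at 0 of the Laplace transform, as moments of [h]. *)
Definition laplace_coef h (n : nat) : R[i] :=
  Cintegral (fun t => h t * ((- t%:C) ^+ n / n`!%:R)).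

Lemma exp_integrable_norm h : exp_integrable h ->
  mu.-integrable setT (EFin \o (fun t => normc (h t))).
Proof.
move=> [_ /(_ 0)]; apply: eq_integrable => // t _ /=.
by rewrite mul0r expR0 mulr1.
Qed.

Lemma laplace_coef_cintegrable h n : exp_integrable h ->
  cintegrable (fun t => h t * ((- t%:C) ^+ n / n`!%:R)).
Proof.
move=> [mh ih]; apply: le_cintegrable (ih 1).
  apply: cmeasurableM => //; apply: cmeasurableM; last exact: cmeasurable_cst.
  apply: cmeasurableX; under eq_fun do rewrite -mulN1r.
  apply: cmeasurableM; first exact: cmeasurable_cst.
  by apply: cmeasurable_real; exact: measurable_id.
move=> t; rewrite normcM ler_wpM2l ?normc_ge0// normcM normcX normcN normc_real.
rewrite normcV normc_nat mul1r.
apply: le_trans (expR_partial_sum_le n.+1 (normr_ge0 t)).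
rewrite big_nat_recr//= lerDr; apply: sumr_ge0 => k _.
by rewrite divr_ge0// exprn_ge0.
Qed.

(** Only [|t| <= T] matters, since [h] vanishes almost everywhere else. There the [n]-th moment
    kernel is at most [T^n / n!], and the remainder of the exponential series is at most the real
    one at [|zeta| T]. *)
Lemma laplace_series h T : exp_integrable h -> 0 <= T -> ess_support_le h T ->
  exists2 M : R,
    forall n, normc (laplace_coef h n) <= M * (T ^+ n / n`!%:R) &
    forall zeta, ccvg \oo (fun n => \sum_(0 <= k < n) laplace_coef h k * zeta ^+ k)
                      (laplace h zeta).
Proof.
move=> eh T0 hT; pose I := Rintegral mu setT (fun t => normc (h t)).
have ih := exp_integrable_norm eh.
have bound (F : R -> R[i]) (B : R) : 0 <= B ->
    cintegrable (fun t => h t * F t) -> (forall t, `|t| <= T -> normc (F t) <= B) ->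
    normc (Cintegral (fun t => h t * F t)) <= 2 * I * B.
  move=> B0 iF FB; rewrite -mulrA -RintegralZr//.
  apply: normc_Cintegral_le => //.
  - by apply: eq_integrable (integrableZr measurableT B ih).
  - by move=> t; rewrite mulr_ge0 ?normc_ge0.
  apply: ae_imply hT => t ht; rewrite normcM.
  have [tT|Tt] := leP `|t| T; last by rewrite (ht Tt) normc0 !mul0r.
  by rewrite ler_wpM2l ?normc_ge0 ?FB.
exists (2 * I) => [n|zeta].
  apply: bound; first by rewrite divr_ge0 ?exprn_ge0.
    exact: laplace_coef_cintegrable.
  move=> t tT; rewrite normcM normcX normcN normc_real normcV normc_nat.
  by rewrite ler_wpM2r// lerXn2r// nnegrE.
pose r := normc zeta * T.
apply: (@ccvg_squeeze _ _ _ _ _ _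
  (fun n => 2 * I * (expR r - \sum_(0 <= k < n) r ^+ k / k`!%:R))).
  apply: filterE => n; rewrite normc_distC.
  have ik k : cintegrable (fun t => zeta ^+ k * (h t * ((- t%:C) ^+ k / k`!%:R))).
    exact/cintegrableZl/laplace_coef_cintegrable.
  have [iS SE] := Cintegral_sum n ik.
  have il := laplace_cintegrable zeta eh.
  have E t : h t * cexp (- (zeta * t%:C)) -
      \sum_(0 <= k < n) zeta ^+ k * (h t * ((- t%:C) ^+ k / k`!%:R)) =
      h t * (cexp (- (zeta * t%:C)) - \sum_(0 <= k < n) (- (zeta * t%:C)) ^+ k / k`!%:R).
    rewrite mulrBr; congr (_ - _); rewrite mulr_sumr; apply: eq_bigr => k _.
    by rewrite -mulrN exprMn; ring.
  have -> : laplace h zeta - \sum_(0 <= k < n) laplace_coef h k * zeta ^+ k =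
      Cintegral (fun t => h t * (cexp (- (zeta * t%:C)) -
        \sum_(0 <= k < n) (- (zeta * t%:C)) ^+ k / k`!%:R)).
    rewrite -(eq_Cintegral E) CintegralB// SE; congr (_ - _); apply: eq_bigr => k _.
    by rewrite CintegralZl 1?mulrC//; exact: laplace_coef_cintegrable.
  apply: bound.
  - by rewrite subr_ge0 expR_partial_sum_le// mulr_ge0 ?normc_ge0.
  - have := cintegrableD il (cintegrableZl (-1) iS).
    by congr cintegrable; apply/funext => t; rewrite -E mulN1r.
  move=> t tT; apply: normc_cexp_remainder.
  by rewrite normcN normcM normc_real ler_wpM2l ?normc_ge0.
have E0 : 2 * I * (expR r - expR r) = 0 by rewrite subrr mulr0.
rewrite -[X in _ --> X]E0.
apply: cvgM; first exact: cvg_cst.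
by apply: cvgB; [exact: cvg_cst | exact: (@expR_series R r)].
Qed.

(** For fixed [s], [e^(- zeta t) = e^(zeta s) e^(- zeta (s + t))]; after Fubini and a translation
    the double integral factors. *)
Lemma autocorrelation_laplace h zeta : exp_integrable h ->
  autocorrelation h zeta = laplace h zeta * conjc (laplace h (- conjc zeta)).
Proof.
move=> eh; have [mh ih] := eh.
pose c := normc zeta; pose k t := normc (h t) * expR (c * `|t|).
have k0 t : 0 <= k t by rewrite mulr_ge0 ?normc_ge0 ?expR_ge0.
have ik := ih c.
have /integrableP[/measurable_EFinP mk koo] := ik.
have mD : measurable_fun setT (fun p : R * R => p.2 + p.1).
  by apply: measurable_funD; [exact: measurable_snd | exact: measurable_fst].
(* With [p = (t, s)], [|t| <= |s| + |s + t|] splits the weight between the two factors and gives the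
   majorant [k(s) k(s + t)]. *)
have ckernel (p : R * R) : expR (c * `|p.1|) <= expR (c * `|p.2|) * expR (c * `|p.2 + p.1|).
  rewrite -expRD ler_expR -mulrDr ler_wpM2l ?normc_ge0//.
  by rewrite -{1}(addKr p.2 p.1) (le_trans (ler_normD _ _))// normrN.
pose kk (p : R * R) := k p.2 * k (p.2 + p.1).
have ikk : (mu \x mu)%E.-integrable setT (EFin \o kk).
  apply/integrable21ltyP.
    apply/measurable_EFinP/measurable_funM.
      exact: measurableT_comp mk measurable_snd.
    exact: measurableT_comp mk mD.
  have intk : (\int[mu]_t (k t)%:E = (Rintegral mu setT k)%:E)%E.
    by rewrite /Rintegral fineK//; exact: integrable_fin_num ik.
  (* Integrating first in [t], translation invariance replaces the integral of [k (s + t)] by that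
     of [k]; the double integral is the square of a finite number. *)
  rewrite (eq_integral (fun s : measurableTypeR R => (k s)%:E * (Rintegral mu setT k)%:E))%E; last first.
    move=> s _; rewrite -intk -(ge0_integral_shift s (k := EFin \o k)); last 2 first.
    - exact/measurable_EFinP.
    - by move=> t; rewrite /= lee_fin.
    rewrite -ge0_integralZl//.
    - by apply: eq_integral => t _; rewrite /kk/= (ger0_norm (mulr_ge0 (k0 _) (k0 _))) EFinM.
    - apply/measurable_EFinP; apply: (measurableT_comp mk).
      by apply: (measurable_funD (measurable_cst _)); exact: measurable_id.
    - by move=> t _; rewrite /= lee_fin.
    - by rewrite lee_fin.
  rewrite ge0_integralZr//.
  - by rewrite intk -EFinM ltry.
  - exact/measurable_EFinP.
  - by move=> x _; rewrite lee_fin; exact: k0.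
  - by rewrite lee_fin; apply: Rintegral_ge0 => x _; exact: k0.
pose F (p : R * R) := conjc (h p.2) * h (p.2 + p.1) * cexp (- (zeta * p.1%:C)).
have mF : cmeasurable F.
  apply: cmeasurableM; last first.
    have [re im] := cmeasurable_laplace_kernel zeta.
    by split; [apply: (measurableT_comp re) | apply: (measurableT_comp im)]; exact: measurable_fst.
  apply: cmeasurableM.
    apply: cmeasurable_conj; case: mh => re im.
    by split; [apply: (measurableT_comp re) | apply: (measurableT_comp im)]; exact: measurable_snd.
  case: mh => re im.
  by split; [apply: (measurableT_comp re) | apply: (measurableT_comp im)].
have Fkk p : normc (F p) <= kk p.
  rewrite /F normcM (normcM (conjc (h p.2))) normc_conj /kk /k [leRHS]mulrACA ler_wpM2l ?mulr_ge0 ?normc_ge0//.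
  by apply: le_trans (ckernel p); exact: normc_laplace_kernel.
rewrite -[autocorrelation _ _]/(Cintegral (fun x => Cintegral (fun y => F (x, y)))).
rewrite (Cintegral_Fubini mF Fkk ikk).
have inner s : Cintegral (fun t => F (t, s)) =
    laplace h zeta * conjc (h s * cexp (- (- conjc zeta * s%:C))).
  rewrite (eq_Cintegral (g := fun t => conjc (h s) * cexp (zeta * s%:C) *
     (h (s + t) * cexp (- (zeta * (s + t)%:C))))); last first.
    move=> t; rewrite /F /= rmorphD mulrDr opprD cexpD.
    rewrite [cexp (- (zeta * s%:C))]cexpN; field; exact: cexp_neq0.
  have il := laplace_cintegrable zeta eh.
  rewrite CintegralZl; last exact: cintegrable_shift il.
  rewrite (Cintegral_shift s il) mulrC; congr (_ * _).
  rewrite conjcM -cexp_conj; congr (_ * cexp _).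
  by rewrite mulNr opprK conjcM conjcK conjc_real.
rewrite (eq_Cintegral inner).
have il := laplace_cintegrable (- conjc zeta) eh.
have ilc : cintegrable (fun t => conjc (h t * cexp (- (- conjc zeta * t%:C)))).
  apply: le_cintegrable (ih (normc (- conjc zeta))).
    apply: cmeasurable_conj; apply: cmeasurableM => //; exact: cmeasurable_laplace_kernel.
  move=> t; rewrite normc_conj normcM ler_wpM2l ?normc_ge0//.
  exact: normc_laplace_kernel.
by rewrite CintegralZl// Cintegral_conj.
Qed.

Lemma theta_chirp_exp_integrable (s : R[i]) (a b : R) f :
  exp_integrable f -> exp_integrable (theta_chirp s a b f).
Proof.
apply: (@exp_integrableM _ _ (normc (theta s))).
  apply: cmeasurableM; first exact: cmeasurable_cst.
  apply: cmeasurable_cexp; apply: cmeasurable_imag.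
  by apply: measurable_funM; [exact: measurable_cst | exact: exprn_measurable].
by move=> t; rewrite normcM normc_cexp/= expR0 mulr1.
Qed.

Lemma theta_chirp_ess_support (s : R[i]) (a b : R) f T :
  ess_support_le f T -> ess_support_le (theta_chirp s a b f) T.
Proof. by apply: ae_imply => t ft Tt; rewrite /theta_chirp ft// mulr0. Qed.

(** The kernel is [theta] times the chirp in [t], the exponential [e^(- i omega t / b)] and a phase
    in [omega] alone, which has modulus 1. *)
Lemma normc_LCT (s : R[i]) (a b d : R) f (omega : R) : b != 0 -> exp_integrable f ->
  normc (LCT s a b d f omega) =
  normc (laplace (theta_chirp s a b f) (0 +i* (omega / b))).
Proof.
move=> b0 ef; pose phase : R[i] := cexp (0 +i* (d / b * omega ^+ 2 / 2)).
have -> : LCT s a b d f omega = phase * laplace (theta_chirp s a b f) (0 +i* (omega / b)).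
  rewrite /laplace -CintegralZl; last first.
    exact/laplace_cintegrable/theta_chirp_exp_integrable.
  apply: eq_Cintegral => t; rewrite /LCT_kernel /theta_chirp /phase.
  rewrite [RHS](_ : _ = f t * (theta s * (cexp (0 +i* (d / b * omega ^+ 2 / 2)) *
     cexp (0 +i* (a / (2 * b) * t ^+ 2)) * cexp (- ((0 +i* (omega / b)) * t%:C))))); last ring.
  rewrite -!cexpD; congr (_ * (_ * cexp _)).
  by simpc; congr (_ +i* _); field.
by rewrite normcM normc_cexp/= expR0 mul1r.
Qed.

End LaplaceTransform.

(** * Entire functions of exponential type *)

Section ExponentialType.
Context {R : realType}.
Implicit Types (c d : nat -> R[i]) (F G : R[i] -> R[i]) (z : R[i]).

(** With [M] and [T] existential, this says that [F] is entire of finite exponential type, in terms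
    of Taylor coefficients only. *)
Definition exp_type_series c F := exists M T : R,
  [/\ 0 <= T, forall n, normc (c n) <= M * (T ^+ n / n`!%:R)
    & forall z, ccvg \oo (fun n => \sum_(0 <= k < n) c k * z ^+ k) (F z)].

(** The binomial theorem turns the Cauchy product of the majorants into [A B (S + T)^n / n!]. *)
Lemma exp_type_seriesM c d F G : exp_type_series c F -> exp_type_series d G ->
  exp_type_series (fun n => \sum_(0 <= i < n.+1) c i * d (n - i)%N)
    (fun z => F z * G z).
Proof.
move=> [A [S [S0 cA cF]]] [B [T [T0 dB dG]]].
exists (A * B), (S + T); split; first exact: addr_ge0.
  move=> n; rewrite -binomial_factorial mulr_sumr.
  apply: le_trans (le_normc_sum _ _ _) _; apply: ler_sum => i _.
  rewrite normcM mulrACA; apply: ler_pM => //; exact: normc_ge0.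
move=> z; have scaled (e : nat -> R[i]) (E U : R) :
    (forall n, normc (e n) <= E * (U ^+ n / n`!%:R)) ->
    forall n, normc (e n * z ^+ n) <= E * ((U * normc z) ^+ n / n`!%:R).
  move=> eE n; rewrite normcM normcX exprMn mulrAC mulrA.
  by rewrite ler_wpM2r// exprn_ge0// normc_ge0.
have := cauchy_product (mulr_ge0 S0 (normc_ge0 z)) (mulr_ge0 T0 (normc_ge0 z))
  (scaled _ _ _ cA) (scaled _ _ _ dB) (cF z) (dG z).
apply: eq_ccvg => n; apply: eq_bigr => k _; rewrite mulr_suml.
rewrite big_nat [RHS]big_nat; apply: eq_bigr => i /andP[_ ik].
by rewrite mulrACA -exprD subnKC.
Qed.

Lemma exp_type_seriesB c d F G : exp_type_series c F -> exp_type_series d G ->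
  exp_type_series (fun n => c n - d n) (fun z => F z - G z).
Proof.
move=> [A [S [S0 cA cF]]] [B [T [T0 dB dG]]].
have nonneg (e : nat -> R[i]) (E U : R) :
    (forall n, normc (e n) <= E * (U ^+ n / n`!%:R)) -> 0 <= E.
  by move=> /(_ 0%N); rewrite expr0 divr1 mulr1; apply: le_trans; exact: normc_ge0.
have A0 := nonneg _ _ _ cA; have B0 := nonneg _ _ _ dB.
exists (A + B), (S + T); split; first exact: addr_ge0.
  move=> n; apply: le_trans (le_normcB _ _) _; rewrite mulrDl lerD//.
    apply: le_trans (cA n) _; rewrite ler_wpM2l// ler_wpM2r//.
    by rewrite lerXn2r// ?nnegrE ?addr_ge0// lerDl.
  apply: le_trans (dB n) _; rewrite ler_wpM2l// ler_wpM2r//.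
  by rewrite lerXn2r// ?nnegrE ?addr_ge0// lerDr.
move=> z; apply: eq_ccvg (ccvgB (cF z) (dG z)) => n.
by rewrite -sumrB; apply: eq_bigr => k _; rewrite mulrBl.
Qed.

Lemma exp_type_series_reflect c F : exp_type_series c F ->
  exp_type_series (fun n => conjc (c n) * (-1) ^+ n) (fun z => conjc (F (- conjc z))).
Proof.
move=> [A [S [S0 cA cF]]]; exists A, S; split=> // [n|z].
  by rewrite normcM normcX normcN normc1 expr1n mulr1 normc_conj.
apply: eq_ccvg (ccvg_conj (cF (- conjc z))) => n.
rewrite (rmorph_sum (@conjc R)); apply: eq_bigr => k _.
rewrite /= conjcM (rmorphXn (@conjc R))/= (raddfN (@conjc R))/= conjcK.
by rewrite -mulrA -exprMn mulN1r.
Qed.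

(** An identity theorem on the imaginary axis: once the coefficients below [n] vanish, dividing by
    [y^n] and letting [y] tend to 0 gives [c n = 0]. *)
Lemma exp_type_series_eq0 c F : exp_type_series c F ->
  (forall y : R, F (0 +i* y) = 0) -> forall n, c n = 0.
Proof.
move=> [M [T [T0 cM cF]]] F0.
have M0 : 0 <= M.
  by have := cM 0%N; rewrite expr0 divr1 mulr1; apply: le_trans; exact: normc_ge0.
elim/ltn_ind => n IH; apply/eqP; rewrite -normc_eq0 eq_le normc_ge0 andbT.
(* For [y <= 1] the terms of degree above [n] amount to at most [y^(n+1) M e^T], and they must
   cancel the term of degree [n]. *)
have key (y : R) : 0 < y -> y <= 1 -> normc (c n) <= y * (M * expR T).
  move=> y0 y1; have yn : 0 < y ^+ n by rewrite exprn_gt0.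
  rewrite -(ler_pM2r yn) -subr_le0 -(normc0 R) -(F0 y).
  apply: (ccvg_ge (cF (0 +i* y))); exists n.+1 => // N /= nN.
  have ny k : normc ((0 +i* y) ^+ k) = y ^+ k by rewrite normcX normc_imag ger0_norm// ltW.
  rewrite (big_cat_nat (leq0n n.+1) nN)/= big_nat_recr//= big1_seq ?add0r; last first.
    by move=> k; rewrite mem_index_iota => /andP[_ /andP[_ kn]]; rewrite IH ?mul0r.
  set t := \sum_(n.+1 <= k < N) _.
  have tle : normc t <= y * (M * expR T) * y ^+ n.
    apply: le_trans (le_normc_sum _ _ _) _.
    apply: (@le_trans _ _ (\sum_(n.+1 <= k < N) y ^+ n.+1 * M * (T ^+ k / k`!%:R))).
      rewrite big_nat [leRHS]big_nat; apply: ler_sum => k /andP[nk _].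
      rewrite normcM ny mulrC -mulrA; apply: ler_pM => //; first exact/exprn_ge0/ltW.
        exact: normc_ge0.
      by rewrite ler_wiXn2l// ltW.
    rewrite -mulr_sumr (_ : y * _ * _ = y ^+ n.+1 * M * expR T); last by rewrite exprS; ring.
    rewrite ler_wpM2l//; first by rewrite mulr_ge0// exprn_ge0// ltW.
    apply: le_trans (expR_partial_sum_le N T0).
    rewrite [leRHS](big_cat_nat (leq0n n.+1) nN)/= lerDr sumr_ge0// => k _.
    by rewrite divr_ge0// exprn_ge0.
  have := le_normc_dist (c n * (0 +i* y) ^+ n) (- t).
  rewrite opprK normcN normcM ny => /(le_trans (ler_norm _)).
  by move: tle; lra.
have lim : (1 / k.+1%:R * (M * expR T) : R) @[k --> \oo] --> (0 : R).
  rewrite -[X in _ --> X](mul0r (M * expR T)); apply: cvgM; last exact: cvg_cst.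
  by under eq_fun do rewrite div1r; exact: cvg_harmonic.
apply: (cvgr_to_ge lim); apply: filterE => k; apply: key; first by rewrite divr_gt0.
by rewrite ler_pdivrMr// mul1r ler1n.
Qed.

Lemma exp_type_series_ext c F : exp_type_series c F ->
  (forall y : R, F (0 +i* y) = 0) -> forall z, F z = 0.
Proof.
move=> cF F0 z; have c0 := exp_type_series_eq0 cF F0.
have [M [T [_ _ /(_ z)]]] := cF => Fz; apply: ccvg_unique Fz _.
apply: eq_ccvg (ccvg_cst 0) => n; rewrite big1// => k _.
by rewrite c0 mul0r.
Qed.

(** The zero of order [m] at the origin is divided out; the quotient has constant coefficient 1 and
    obeys a bound of the same kind, so [hadamard_factorization] applies. Its first coefficient
    becomes [gamma]. *)
Lemma exp_type_factorization c F : exp_type_series c F -> (exists n, c n != 0) ->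
  exists (C gamma : R[i]) (m : nat) (u : nat -> R[i]) (K : R) (P : R[i] -> R[i]),
    [/\ C != 0, forall j, normc (u j) <= K / j.+1%:R,
        forall z, ccvg \oo (fun n => canonical_prod u n z) (P z)
      & forall z, F z = C * z ^+ m * cexp (z * gamma) * P z].
Proof.
move=> [M [T [T0 cM cF]]] ex; pose m := ex_minn ex.
have [cm mmin] : c m != 0 /\ forall k, (k < m)%N -> c k = 0.
  rewrite /m; case: ex_minnP => i ci imin; split=> // k ki.
  by apply/eqP; apply: contraTT ki => /imin; rewrite -leqNgt.
have F00 : F 0 = c 0%N.
  apply: ccvg_unique (cF 0) _; apply: (@ccvg_squeeze _ _ _ _ _ _ (fun=> 0)).
    exists 1%N => // -[//|n] _; rewrite big_nat_recl//= expr0 mulr1 big1 ?addr0 ?subrr ?normc0//.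
    by move=> k _; rewrite expr0n mulr0.
  exact: cvg_cst.
pose d n := c (m + n)%N / c m.
pose G z := if z == 0 then 1 else F z / (c m * z ^+ m).
have d0 : d 0%N = 1 by rewrite /d addn0 divff.
have M0 : 0 <= M.
  by have := cM 0%N; rewrite expr0 divr1 mulr1; apply: le_trans; exact: normc_ge0.
(* The power [T^m] joins the constant, and [(m + n)!] is bounded below by [n!]. *)
have dM n : normc (d n) <= M * T ^+ m / normc (c m) * (T ^+ n / n`!%:R).
  rewrite /d normcM normcV mulrAC ler_wpM2r ?invr_ge0 ?normc_ge0//.
  apply: le_trans (cM _) _; rewrite -mulrA ler_wpM2l// exprD -mulrA.
  rewrite ler_wpM2l ?exprn_ge0// ler_wpM2l ?exprn_ge0//.
  rewrite lef_pV2 ?posrE ?ltr0n ?fact_gt0// ler_nat.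
  by rewrite leq_fact// leq_addl.
have dG z : ccvg \oo (fun n => \sum_(0 <= k < n) d k * z ^+ k) (G z).
  rewrite /G; have [->|z0] := eqVneq z 0.
    apply: (@ccvg_squeeze _ _ _ _ _ _ (fun=> 0)); last exact: cvg_cst.
    exists 1%N => // -[//|n] _; rewrite big_nat_recl//= expr0 mulr1 big1 ?addr0 ?d0 ?subrr ?normc0//.
    by move=> k _; rewrite expr0n mulr0.
  have h : ccvg \oo (fun n => \sum_(0 <= k < n + m) c k * z ^+ k) (F z).
    by have := cF z; rewrite /ccvg -(cvg_shiftn m).
  apply: eq_ccvg (ccvgM h (ccvg_cst (c m * z ^+ m)^-1)) => n.
  rewrite (big_cat_nat (leq0n m) (leq_addl n m))/= big1_seq ?add0r; last first.
    by move=> k; rewrite mem_index_iota => /andP[_ /andP[_ km]]; rewrite mmin ?mul0r.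
  rewrite mulr_suml -{1}(add0n m) big_addn addnK; apply: eq_bigr => k _.
  rewrite /d exprD addnC; field.
  by rewrite cm expf_neq0.
have Tm0 : 0 <= M * T ^+ m / normc (c m).
  by rewrite divr_ge0 ?mulr_ge0 ?exprn_ge0 ?normc_ge0.
have [u [K uK uP]] := hadamard_factorization d0 T0 dM dG.
exists (c m), (d 1%N), m, u, K, (fun z => G z * cexp (- (d 1%N * z))); split=> // z.
rewrite [in RHS](mulrC (G z)) mulrA -(mulrA (c m * z ^+ m)) -cexpD (mulrC z) subrr cexp0 mulr1.
rewrite /G; have [->|z0] := eqVneq z 0; last by field; rewrite cm expf_neq0.
(* At the origin, where [G] was set to 1, either [m = 0] or both sides vanish. *)
rewrite F00 mulr1; case: (posnP m) => [m0|m0]; first by rewrite m0 expr0 mulr1.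
by rewrite mmin// expr0n gtn_eqF// mulr0.
Qed.

End ExponentialType.

(** * Multiplicities and zero pairs *)

Section ZeroOrder.
Context {R : realType}.
Implicit Types (z w : R[i]) (phi psi : R[i] -> R) (u : nat -> R[i]).

Local Notation near_pt z := (nbhs ((z : R[i]) : R[i]^o)).

#[local] Instance near_pt_proper z : ProperFilter (near_pt z).
Proof. exact: nbhs_pfilter. Qed.

(* Multiplicities are read off from moduli alone, which needs no analyticity. *)
Definition order_at phi z (k : nat) := exists c1 c2 : R,
  [/\ 0 < c1, 0 < c2 & \forall w \near (z : R[i]^o),
    c1 * normc (w - z) ^+ k <= phi w <= c2 * normc (w - z) ^+ k].

Lemma ccvg_id z : ccvg (near_pt z) (fun w : R[i]^o => w) z.
Proof. by apply/cvg_ccvgP; exact: cvg_id. Qed.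

(** Along [z + 1 / (n + 1)], the lower bound of order [k] and the upper bound of order [l > k] force
    [a <= b / (n + 1)] for large [n], contradicting [0 < a]. *)
Lemma order_at_unique phi z k l : order_at phi z k -> order_at phi z l -> k = l.
Proof.
wlog kl : k l / (k <= l)%N.
  by move=> H hk hl; case: (leqP k l) => [|/ltnW] kl; [exact: H | apply/esym/H].
move=> [a [a' [a0 _ hk]]] [b' [b [_ b0 hl]]].
apply/eqP; rewrite eqn_leq kl/= leqNgt; apply/negP => lk.
pose t n : R := n.+1%:R^-1.
have tz : ccvg \oo (fun n => z + (t n)%:C) z.
  apply: (@ccvg_squeeze _ _ _ _ _ _ t); last exact: cvg_harmonic.
  apply: filterE => n; rewrite addrC addKr normc_real ger0_norm//.
  by rewrite invr_ge0.
move/cvg_ccvgP in tz.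
have nt n : normc (z + (t n)%:C - z) = t n.
  by rewrite addrC addKr normc_real ger0_norm// invr_ge0.
have {}hk : \forall n \near \oo, a * normc (z + (t n)%:C - z) ^+ k <=
    phi (z + (t n)%:C) <= a' * normc (z + (t n)%:C - z) ^+ k := tz _ hk.
have {}hl : \forall n \near \oo, b' * normc (z + (t n)%:C - z) ^+ l <=
    phi (z + (t n)%:C) <= b * normc (z + (t n)%:C - z) ^+ l := tz _ hl.
have h0 : (b * t n) @[n --> \oo] --> (b * 0 : R).
  by apply: cvgM; [exact: cvg_cst | exact: cvg_harmonic].
have : a <= b * 0.
  apply: (cvgr_to_ge h0); near=> n.
  have t0 : 0 < t n by rewrite invr_gt0.
  have t1 : t n <= 1 by rewrite invf_le1// ler1n.
  have /andP[h1 _] : a * normc (z + (t n)%:C - z) ^+ k <=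
    phi (z + (t n)%:C) <= a' * normc (z + (t n)%:C - z) ^+ k by near: n.
  have /andP[_ h2] : b' * normc (z + (t n)%:C - z) ^+ l <=
    phi (z + (t n)%:C) <= b * normc (z + (t n)%:C - z) ^+ l by near: n.
  rewrite nt in h1 h2.
  rewrite -(ler_pM2r (exprn_gt0 k t0)); apply: le_trans h1 (le_trans h2 _).
  rewrite -mulrA -exprS ler_wpM2l ?(ltW b0)//.
  by rewrite ler_wiXn2l// ltW.
by rewrite mulr0 leNgt a0.
Unshelve. all: end_near. Qed.

Lemma order_atM phi psi z k l : order_at phi z k -> order_at psi z l ->
  order_at (fun w => phi w * psi w) z (k + l).
Proof.
move=> [a [b [a0 b0 h]]] [a' [b' [a'0 b'0 h']]].
exists (a * a'), (b * b'); split; [exact: mulr_gt0 | exact: mulr_gt0 |].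
near=> w.
have n0 j : 0 <= normc (w - z) ^+ j by rewrite exprn_ge0// normc_ge0.
have /andP[h1 h2] : a * normc (w - z) ^+ k <= phi w <= b * normc (w - z) ^+ k by near: w.
have /andP[h3 h4] : a' * normc (w - z) ^+ l <= psi w <= b' * normc (w - z) ^+ l by near: w.
have p1 : 0 <= a * normc (w - z) ^+ k by rewrite mulr_ge0// ltW.
have p3 : 0 <= a' * normc (w - z) ^+ l by rewrite mulr_ge0// ltW.
rewrite !exprD mulrACA [X in _ && (_ <= X)]mulrACA.
apply/andP; split; apply: ler_pM => //; first exact: le_trans p1 h1.
exact: le_trans p3 h3.
Unshelve. all: end_near. Qed.

Lemma order_at_prod (I : Type) (s : seq I) (phi : I -> R[i] -> R) (k : I -> nat) z :
  (forall i, order_at (phi i) z (k i)) ->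
  order_at (fun w => \prod_(i <- s) phi i w) z (\sum_(i <- s) k i).
Proof.
move=> h; elim: s => [|i s IH].
  rewrite big_nil; exists 1, 1; split=> //; apply: filterE => w.
  by rewrite big_nil expr0 mulr1 lexx.
rewrite big_cons; under eq_fun do rewrite big_cons.
exact: order_atM.
Qed.

Lemma order_at_equiv phi psi z k (a b : R) : 0 < a -> 0 < b ->
  (\forall w \near (z : R[i]^o), a * phi w <= psi w <= b * phi w) ->
  order_at phi z k -> order_at psi z k.
Proof.
move=> a0 b0 h [c [d [c0 d0 h']]].
exists (a * c), (b * d); split; [exact: mulr_gt0 | exact: mulr_gt0 |].
near=> w.
have /andP[h1 h2] : a * phi w <= psi w <= b * phi w by near: w.
have /andP[h3 h4] : c * normc (w - z) ^+ k <= phi w <= d * normc (w - z) ^+ k by near: w.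
rewrite -!mulrA (le_trans _ h1) ?ler_pM2l//=.
by rewrite (le_trans h2)// ler_pM2l.
Unshelve. all: end_near. Qed.

Lemma order_at_cvg (f : R[i] -> R[i]) z l : ccvg (near_pt z) (f : R[i]^o -> R[i]) l ->
  l != 0 -> order_at (fun w => normc (f w)) z 0.
Proof.
move=> fl; rewrite -normc_gt0 => l0.
exists (normc l / 2), (2 * normc l); split; [by rewrite divr_gt0 | by rewrite mulr_gt0 |].
have hn : normc (f w) @[w --> (z : R[i]^o)] --> normc l by exact: ccvg_norm.
near=> w.
rewrite expr0 !mulr1; apply/andP; split; near: w.
  by apply: (cvgr_ge _ hn); lra.
by apply: (cvgr_le _ hn); lra.
Unshelve. all: end_near. Qed.

Lemma order_at_exp z k : order_at (fun w => normc (w - z) ^+ k) z k.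
Proof. by exists 1, 1; split=> //; apply: filterE => w; rewrite mul1r lexx. Qed.

Lemma order_at_conj phi z k : order_at phi (- conjc z) k ->
  order_at (fun w => phi (- conjc w)) z k.
Proof.
move=> [a [b [a0 b0 h]]]; exists a, b; split=> //.
have c : ccvg (near_pt z) (fun w : R[i]^o => - conjc w) (- conjc z).
  exact/ccvgN/ccvg_conj/ccvg_id.
move/cvg_ccvgP in c.
have dE w : normc (- conjc w - - conjc z) = normc (w - z).
  by rewrite -opprD normcN -(rmorphB (@conjc R)) normc_conj.
have {}h : \forall w \near (z : R[i]^o), a * normc (- conjc w - - conjc z) ^+ k <=
    phi (- conjc w) <= b * normc (- conjc w - - conjc z) ^+ k := c _ h.
by near=> w; rewrite -dE; near: w.
Unshelve. all: end_near. Qed.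

(** The boolean counts as 0 or 1. When [v z = 1] the factor equals [v (z - w) e^(v w)], which has a
    simple zero. *)
Lemma order_at_efactor (v : R[i]) z :
  order_at (fun w => normc (efactor (v * w))) z (v * z == 1).
Proof.
have vw : ccvg (near_pt z) (fun w : R[i]^o => v * w) (v * z).
  by apply: ccvgM; [exact: ccvg_cst | exact: ccvg_id].
have [vz|vz] := eqVneq (v * z) 1; last first.
  apply: order_at_cvg (ccvg_efactor _ vw) _.
  by rewrite /efactor mulf_neq0 ?cexp_neq0// subr_eq0 eq_sym.
have v0 : v != 0 by apply: contra_eq_neq vz => ->; rewrite mul0r eq_sym oner_neq0.
have vc : ccvg (near_pt z) (fun w : R[i]^o => v * cexp (v * w)) (v * cexp (v * z)).
  by apply: ccvgM; [exact: ccvg_cst | exact: ccvg_cexp].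
have h := order_atM (order_at_exp z 1) (order_at_cvg vc (mulf_neq0 v0 (cexp_neq0 _))).
apply: order_at_equiv ltr01 ltr01 _ h; apply: filterE => w.
rewrite /efactor -vz -mulrBr !mul1r expr1 normcM [in X in _ <= X <= _]normcM normc_distC.
by rewrite [normc (v * (z - w))]normcM (normc_distC z) mulrA [normc v * _]mulrC lexx.
Qed.

Lemma zero_order_order_at (F : R[i] -> R[i]) z k : zero_order F z k ->
  order_at (fun w => normc (F w)) z k.
Proof.
move=> [G [dG Gz FG]].
have cG : ccvg (near_pt z) (G : R[i]^o -> R[i]) (G z).
  apply/cvg_ccvgP; apply: differentiable_continuous.
  exact/derivable1_diffP.
have := order_atM (order_at_exp z k) (order_at_cvg cG Gz).
rewrite addn0; under [X in order_at X _ _ -> _]eq_fun do rewrite -normcX -normcM -FG.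
by [].
Qed.

(** For large [N], near [z], the infinite product differs from its first [N] factors by at most half
    of their modulus; so [F] is comparable to the prefactor times these factors, whose orders add
    up. *)
Lemma order_at_canonical (C gamma : R[i]) (m : nat) u (K : R) (P F : R[i] -> R[i]) z :
  C != 0 -> (forall j, normc (u j) <= K / j.+1%:R) ->
  (forall w, ccvg \oo (fun n => canonical_prod u n w) (P w)) ->
  (forall w, F w = C * w ^+ m * cexp (w * gamma) * P w) -> z != 0 ->
  \forall N \near \oo,
    order_at (fun w => normc (F w)) z (\sum_(0 <= j < N) (u j * z == 1)%R)%N.
Proof.
(* The radius [|z| + 1] makes the tail bound uniform on the unit disc around [z]. *)
move=> C0 uK uP FE z0; pose r := normc z + 1.
have K0 : 0 <= K by have := le_trans (normc_ge0 _) (uK 0%N); rewrite divr1.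
have r0 : 0 <= r by rewrite addr_ge0 ?normc_ge0.
have tb : \forall N \near \oo, tail_bound K r N <= 1 / 2.
  by apply: (cvgr_le _ (@cvg_tail_bound R K r)); rewrite divr_gt0.
near=> N.
have tN : tail_bound K r N <= 1 / 2 by near: N.
have Xz : C * z ^+ m * cexp (z * gamma) != 0.
  by apply: mulf_neq0 (cexp_neq0 _); apply: mulf_neq0 => //; exact: expf_neq0.
have Xc : ccvg (near_pt z) (fun w : R[i]^o => C * w ^+ m * cexp (w * gamma))
    (C * z ^+ m * cexp (z * gamma)).
  apply: ccvgM; last by apply: ccvg_cexp; exact: ccvgM (ccvg_id z) (ccvg_cst _).
  apply: ccvgM; first exact: ccvg_cst.
  elim: (m) => [|k IH]; first by under eq_fun do rewrite expr0; exact: ccvg_cst.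
  by under eq_fun do rewrite exprS; rewrite exprS; exact: ccvgM (ccvg_id z) IH.
have := order_atM (order_at_cvg Xc Xz)
  (order_at_prod (index_iota 0 N) (fun j => order_at_efactor (u j) z)).
have half0 : 0 < 1 / 2 :> R by rewrite divr_gt0.
rewrite add0n; apply: (order_at_equiv half0 (ltr0Sn R 1)).
near=> w.
have wr : normc w <= r.
  rewrite -(subrK z w) (le_trans (le_normcD _ _))// addrC lerD2l.
  by near: w; apply: (cvgr_le _ (ccvg_id z)); lra.
have dist : normc (P w - canonical_prod u N w) <= normc (canonical_prod u N w) * (1 / 2).
  apply: (ccvg_le (ccvgB (uP w) (ccvg_cst _))); exists N => // M /= NM.
  apply: le_trans (canonical_prod_dist w uK NM) _.
  rewrite ler_wpM2l ?normc_ge0//; apply: (le_trans _ tN).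
  exact: tail_bound_mono (normc_ge0 _) wr (leqnn _).
rewrite -normc_prod -/(canonical_prod u N w) FE (normcM _ (P w)).
have := le_normc_dist (P w) (canonical_prod u N w); rewrite ler_norml => /andP[l1 l2].
have X0 := normc_ge0 (C * w ^+ m * cexp (w * gamma)).
have h1 : 1 / 2 * normc (canonical_prod u N w) <= normc (P w) by move: l1 dist; lra.
have h2 : normc (P w) <= 2 * normc (canonical_prod u N w).
  by have := normc_ge0 (canonical_prod u N w); move: l2 dist; lra.
by apply/andP; split; [rewrite mulrCA | rewrite [leRHS]mulrCA]; rewrite ler_wpM2l.
Unshelve. all: end_near. Qed.

End ZeroOrder.

(** * Counting and matching of indices *)

Section Counting.
Local Open Scope card_scope.

Lemma card_nat_pred (q : nat -> bool) N : (forall j, q j -> (j < N)%N) ->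
  [set j | q j] #= `I_(\sum_(0 <= j < N) q j)%N.
Proof.
move=> qN; pose s := [seq j <- index_iota 0 N | q j].
have us : uniq s by rewrite filter_uniq// iota_uniq.
have -> : (\sum_(0 <= j < N) q j)%N = size s.
  by rewrite size_filter -sum1_count [RHS]big_mkcond.
have -> : [set j | q j] = nth 0%N s @` `I_(size s).
  apply/seteqP; split=> [j qj|_ [i si <-]] /=.
    have js : j \in s by rewrite mem_filter mem_index_iota qj (qN _ qj).
    by exists (index j s); rewrite ?nth_index//= index_mem.
  by have := mem_nth 0%N si; rewrite mem_filter => /andP[].
apply: inj_card_eq => i j; rewrite !inE/= => si sj /eqP.
by rewrite nth_uniq// => /eqP.
Qed.

(** Pairs are interleaved as [2 j + b], which reduces the count to [card_nat_pred]. *)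
Lemma card_pair_pred (Q : nat * bool -> bool) N : (forall p, Q p -> (p.1 < N)%N) ->
  [set p | Q p] #= `I_(\sum_(0 <= j < N) (Q (j, false) + Q (j, true)))%N.
Proof.
move=> QN; pose e (p : nat * bool) := (p.2 + p.1.*2)%N.
have eK p : ((e p)./2, odd (e p)) = p.
  by case: p => j b; rewrite /e/= half_bit_double oddD odd_double oddb addbF.
have ei : {in [set p | Q p] &, injective e}.
  by move=> p p' _ _ h; rewrite -(eK p) h eK.
rewrite card_eq_sym -(card_eqr (inj_card_eq ei)) card_eq_sym.
have -> : e @` [set p | Q p] = [set n | Q (n./2, odd n)].
  apply/seteqP; split=> [_ [p Qp <-]|n Qn] /=; first by rewrite eK.
  by exists (n./2, odd n) => //; rewrite /e/= odd_double_half.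
have -> : (\sum_(0 <= j < N) (Q (j, false) + Q (j, true)) =
    \sum_(0 <= n < N.*2) Q (n./2, odd n))%N.
  elim: {QN} N => [|N IH]; first by rewrite !big_nil.
  by rewrite doubleS !big_nat_recr//= IH odd_double/= doubleK uphalf_double addnA.
by apply: card_nat_pred => n /QN /=; rewrite ltn_half_double.
Qed.

Lemma finite_pair_bound (Q : nat * bool -> bool) k : [set p | Q p] #= `I_k ->
  exists N, forall p, Q p -> (p.1 < N)%N.
Proof.
move=> h; have /finite_seqP[s sE] : finite_set [set p | Q p].
  by apply/finite_setP; exists k.
exists (\max_(p <- s) p.1.+1)%N => p Qp.
have ps : p \in s by have : [set p | Q p] p by []; rewrite sE.
by rewrite (big_rem p)//= leq_maxl.
Qed.

(** Fibres of equal cardinality admit a bijection over each value; the fibres being disjoint, the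
    bijections glue to one map. *)
Lemma fiberwise_matching (Z : Type) (alpha beta : nat -> Z) (D : set nat) :
  (forall c, [set j | alpha j = c] #= [set i | D i /\ beta i = c]) ->
  exists sigma : nat -> nat, [/\ injective sigma,
    forall j, D (sigma j) /\ beta (sigma j) = alpha j &
    forall i, D i -> exists j, sigma j = i].
Proof.
move=> h; have hb c : exists f : nat -> nat,
    set_bij [set j | alpha j = c] [set i | D i /\ beta i = c] f.
  exact/card_set_bijP.
have [f fP] := choice hb; exists (fun j => f (alpha j) j).
have fD j : D (f (alpha j) j) /\ beta (f (alpha j) j) = alpha j.
  by have [fA _ _] := fP (alpha j); exact: fA.
split=> // [j j' e|i Di].
  have aE : alpha j = alpha j' by rewrite -(fD j).2 -(fD j').2 e.
  have [_ inj _] := fP (alpha j'); apply: inj; rewrite ?inE//=.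
  by rewrite -[in LHS]aE.
have [_ _ surj] := fP (beta i); have [|j aj <-] := surj i; first by split.
by exists j; rewrite /= aj.
Qed.

End Counting.

(** * Zero pairs as classes, and rearrangement of products *)

Section PairClasses.
Context {R : realType}.
Implicit Types (z w : R[i]) (v xi : nat -> R[i]).
Local Open Scope card_scope.

(** A complete invariant of the orbit of [z] under reflection in the imaginary axis. *)
Definition pair_class z : R * R := (`|complex.Re z|, complex.Im z).

Lemma pair_classP w z : pair_class w = pair_class z <-> w = z \/ - conjc w = z.
Proof.
case: w => a b; case: z => x y; rewrite /pair_class/=; split.
  move=> [/eqP + ->]; rewrite eqr_norm2 => /orP[/eqP ->|/eqP ->]; [by left | right].
  by simpc.
by move=> [[-> ->]//|]; simpc => -[<- <-]; rewrite normrN.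
Qed.

Lemma pair_eltE v p : pair_elt v p = if p.2 then - conjc (v p.1) else v p.1.
Proof. by []. Qed.

Lemma neg_conjK z : - conjc (- conjc z) = z.
Proof. by rewrite (raddfN (@conjc R))/= conjcK opprK. Qed.

(** When [z] is purely imaginary, an index in its class contributes both of its entries to the count
    [k]; otherwise exactly one. *)
Lemma card_pair_class v z k : [set p | pair_elt v p = z] #= `I_k ->
  [set j | pair_class (v j) = pair_class z] #=
  `I_(if z == - conjc z then k./2 else k).
Proof.
pose Q p := pair_elt v p == z.
have -> : [set p | pair_elt v p = z] = [set p | Q p].
  by apply/seteqP; split=> p /eqP.
move=> Qk; have [N QN] := finite_pair_bound Qk.
have kE : k = (\sum_(0 <= j < N) (Q (j, false) + Q (j, true)))%N.
  by apply/card_eq_II; rewrite card_eq_sym -(card_eqr Qk) card_eq_sym card_pair_pred.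
pose q j := Q (j, false) || Q (j, true).
have -> : [set j | pair_class (v j) = pair_class z] = [set j | q j].
  apply/seteqP; split=> j; rewrite /q /Q /= !pair_eltE/=.
    by move/pair_classP => [->|->]; rewrite eqxx ?orbT.
  by move=> h; apply/pair_classP; case/orP: h => /eqP; [left | right].
have qN j : q j -> (j < N)%N by move=> /orP[] /QN.
have -> : (if z == - conjc z then k./2 else k) = (\sum_(0 <= j < N) q j)%N.
  rewrite kE; case: eqP => zz.
    have E j : Q (j, true) = Q (j, false).
      rewrite /Q !pair_eltE/=; apply/eqP/eqP => [vz|->]; last exact: esym.
      by rewrite -(neg_conjK (v j)) vz; exact: esym.
    under eq_bigr do rewrite E addnn -muln2; rewrite -big_distrl/= muln2 doubleK.
    by apply: eq_bigr => j _; rewrite /q E orbb.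
  apply: eq_bigr => j _; rewrite /q /Q !pair_eltE/=.
  have [vz|_] := eqVneq (v j) z; last by rewrite add0n.
  by rewrite vz; case: eqP => // zz'; case: zz.
exact: card_nat_pred.
Qed.

(** Counts by value become counts by class through [card_pair_class], and [fiberwise_matching] pairs
    the indices. Those with [v i = 0] stand for missing zeros and are left out. *)
Lemma matching_of_pair_counts xi v :
  (forall j, xi j != 0) ->
  (forall z, z != 0 -> exists k,
    [set p | pair_elt xi p = z] #= `I_k /\ [set p | pair_elt v p = z] #= `I_k) ->
  exists sigma : nat -> nat, [/\ injective sigma,
    forall j, v (sigma j) != 0 /\ (v (sigma j) = xi j \/ v (sigma j) = - conjc (xi j)) &
    forall i, v i != 0 -> exists j, sigma j = i].
Proof.
move=> xi0 counts.
have pc0 w : (pair_class w = pair_class 0) -> w = 0.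
  by move/pair_classP => [//|/eqP]; rewrite oppr_eq0 conjc_eq0 => /eqP.
have fibers c : [set j | pair_class (xi j) = c] #=
    [set i | v i != 0 /\ pair_class (v i) = c].
  have [[z zc]|nz] := pselect (exists z, pair_class z = c); last first.
    rewrite (_ : [set j | _] = set0); last first.
      by apply/seteqP; split=> // j /= h; apply: nz; exists (xi j).
    rewrite (_ : [set i | _] = set0); first exact: card_eq00.
    by apply/seteqP; split=> // i /= [_ h]; apply: nz; exists (v i).
  subst c; have [->|z0] := eqVneq z 0.
    rewrite (_ : [set j | _] = set0); last first.
      by apply/seteqP; split=> // j /= /pc0/eqP; rewrite (negbTE (xi0 j)).
    rewrite (_ : [set i | _] = set0); first exact: card_eq00.
    by apply/seteqP; split=> // i /= [+ /pc0 vi]; rewrite vi eqxx.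
  have [k [kxi kv]] := counts z z0.
  have -> : [set i | v i != 0 /\ pair_class (v i) = pair_class z] =
      [set i | pair_class (v i) = pair_class z].
    apply/seteqP; split=> i /=; first by case.
    move=> h; split=> //; apply: contra_neq z0 => vi.
    by apply: pc0; rewrite -h vi.
  rewrite (card_eql (card_pair_class kxi)) card_eq_sym.
  exact: card_pair_class kv.
have [sigma [inj sP surj]] := fiberwise_matching fibers.
exists sigma; split=> // j; have [v0 vxi] := sP j; split=> //.
by have /pair_classP[] := esym vxi; [left | right].
Qed.

(** Once every [i < N] with [u i != 0] has been reached, a rearranged partial product is
    [canonical_prod u N z] times factors with distinct indices at least [N], which [tail_bound]
    controls. *)
Lemma matching_rearrangement (u : nat -> R[i]) (K : R) (sigma : nat -> nat) z P :
  (forall j, normc (u j) <= K / j.+1%:R) -> injective sigma ->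
  (forall i, u i != 0 -> exists j, sigma j = i) ->
  ccvg \oo (fun n => canonical_prod u n z) P ->
  ccvg \oo (fun n => \prod_(0 <= j < n) efactor (u (sigma j) * z)) P.
Proof.
move=> uK inj surj uP; pose B := 1 + tail_bound K (normc z) 0.
have pB n : normc (canonical_prod u n z) <= B by exact: normc_canonical_prod_le.
have B0 : 0 <= B by exact: le_trans (normc_ge0 _) (pB 0%N).
have key N : \forall n \near \oo, normc (\prod_(0 <= j < n) efactor (u (sigma j) * z) -
    canonical_prod u N z) <= B * tail_bound K (normc z) N.
  have [n0 n0P] : exists n0, forall i, (i < N)%N -> u i != 0 ->
      exists2 j, (j < n0)%N & sigma j = i.
    elim: N => [|N [n0 IH]]; first by exists 0%N.
    have [uN|uN] := eqVneq (u N) 0.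
      exists n0 => i; rewrite ltnS leq_eqVlt => /orP[/eqP ->|]; last exact: IH.
      by rewrite uN eqxx.
    have [j0 j0N] := surj N uN; exists (maxn n0 j0.+1) => i.
    rewrite ltnS leq_eqVlt => /orP[/eqP -> _|iN ui]; first by exists j0; rewrite // leq_maxr.
    by have [j jn <-] := IH i iN ui; exists j; rewrite // leq_max jn.
  exists n0 => // n /= nn0; pose S := [seq sigma j | j <- index_iota 0 n].
  have uS : uniq S by rewrite map_inj_uniq// iota_uniq.
  have -> : \prod_(0 <= j < n) efactor (u (sigma j) * z) = \prod_(i <- S) efactor (u i * z).
    by rewrite big_map.
  rewrite (bigID (fun i => (i < N)%N))/=.
  have -> : \prod_(i <- S | (i < N)%N) efactor (u i * z) = canonical_prod u N z.
    rewrite /canonical_prod -big_filter.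
    rewrite (perm_big [seq i <- index_iota 0 N | i \in S]); last first.
      apply: uniq_perm; rewrite ?filter_uniq ?iota_uniq// => i.
      by rewrite !mem_filter mem_index_iota andbC.
    rewrite big_filter [LHS]big_mkcond [LHS]big_nat [RHS]big_nat.
    apply: eq_bigr => i /andP[_ iN]; case: ifPn => // iS.
    (* An index below [N] that is not reached has [u i = 0], and its factor is 1. *)
    have [->|ui] := eqVneq (u i) 0; first by rewrite mul0r efactor0.
    have [j jn ji] := n0P i iN ui; case/negP: iS; apply/mapP; exists j => //.
    by rewrite mem_index_iota (leq_trans jn).
  rewrite -[X in _ - X]mulr1 -mulrBr normcM; apply: ler_pM; rewrite ?normc_ge0//.
  rewrite -big_filter; apply: normc_prod_efactor_sub1 => //; first exact: filter_uniq.
  by apply/allP => i; rewrite mem_filter -leqNgt => /andP[].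
have lim0 : 2 * B * tail_bound K (normc z) N @[N --> \oo] --> (2 * B * 0 : R).
  by apply: cvgM; [exact: cvg_cst | exact: cvg_tail_bound].
rewrite mulr0 in lim0; apply/cvgrPdist_le => e e0.
have [N _ /(_ N (leqnn N))] := cvgr_le _ lim0 _ e0 => /= Ne.
have PN : normc (canonical_prod u N z - P) <= B * tail_bound K (normc z) N.
  rewrite normc_distC; apply: (ccvg_le (ccvgB uP (ccvg_cst _))).
  exists N => // M /= NM; apply: le_trans (canonical_prod_dist z uK NM) _.
  by rewrite ler_wpM2r ?tail_bound_ge0.
near=> n; rewrite sub0r normrN ger0_norm ?normc_ge0//.
rewrite (_ : _ - P = (\prod_(0 <= j < n) efactor (u (sigma j) * z) - canonical_prod u N z) +
   (canonical_prod u N z - P)); last by ring.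
apply: le_trans (le_normcD _ _) _; apply: le_trans Ne.
rewrite -mulrA mulr2n mulrDl mul1r lerD//.
by near: n.
Unshelve. all: end_near. Qed.

End PairClasses.

(** * Factorization of the transform and uniqueness of its constants *)

Section Factorization.
Context {R : realType}.
Implicit Types (F : R[i] -> R[i]) (xi eta : nat -> R[i]) (h : R -> R[i]).

Lemma prod_efactor_div eta n (zeta : R[i]) :
  \prod_(0 <= j < n) ((1 - zeta / eta j) * cexp (zeta / eta j)) =
  \prod_(0 <= j < n) efactor (zeta / eta j).
Proof. by []. Qed.

(* On the imaginary axis the choice of [eta j] in its pair does not affect the
   modulus of the corresponding factor. *)
Lemma product_form_norm F xi C gamma m eta : product_form F xi C gamma m eta ->
  forall y : R, exists2 q : R,
    (fun n => \prod_(0 <= j < n) normc (efactor ((0 +i* y) / xi j))) @ \oo --> q &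
    normc (F (0 +i* y)) = normc C * `|y| ^+ m * expR (- (y * complex.Im gamma)) * q.
Proof.
move=> [etaP FP] y; have [P /cvg_ccvgP cP ->] := FP (0 +i* y).
exists (normc P).
  apply: cvg_trans (ccvg_norm cP); apply: near_eq_cvg; apply: filterE => n.
  rewrite prod_efactor_div normc_prod; apply: eq_bigr => j _.
  have [->//|->] := etaP j.
  rewrite -[RHS]normc_conj -efactor_conj conjCE; congr (normc (efactor _)).
  rewrite conjcM (fmorphV (@conjc R))/= invrN mulrN -mulNr; congr (_ * _).
  by simpc.
rewrite normcM; congr (_ * _); rewrite (normcM (C * _)) (normcM C) normcX normc_imag normc_cexp.
by congr (_ * expR _); case: (gamma) => p r /=; rewrite mul0r sub0r.
Qed.

(** The limit of the products of moduli depends only on [xi], hence cancels between [F] and [F'].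
    The equations at [y] and [- y] then isolate the exponential, and two values of [y] isolate the
    power. *)
Lemma product_form_unique F F' xi C C' gamma gamma' m m' eta eta' (delta : R) :
  product_form F xi C gamma m eta -> product_form F' xi C' gamma' m' eta' ->
  (forall y : R, normc (F' (0 +i* y)) = normc (F (0 +i* y))) ->
  0 < delta -> (forall z : R[i], z != 0 -> normc z <= delta -> F z != 0) ->
  normc C' = normc C /\ complex.Im gamma' = complex.Im gamma.
Proof.
move=> pF pF' FF d0 Fn0.
set t := complex.Im gamma; set t' := complex.Im gamma'.
have eqn (y : R) : y != 0 -> `|y| <= delta ->
    normc C' * `|y| ^+ m' * expR (- (y * t')) = normc C * `|y| ^+ m * expR (- (y * t)).
  move=> y0 yd; have [q cq Fq] := product_form_norm pF y.
  have [q' cq' Fq'] := product_form_norm pF' y.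
  have qq : q' = q by exact: (cvg_unique _ cq' cq).
  have : normc (F (0 +i* y)) != 0.
    rewrite normc_eq0; apply: Fn0; last by rewrite normc_imag.
    by rewrite -normc_eq0 normc_imag normr_eq0.
  have := FF y; rewrite Fq' qq Fq => E; rewrite mulf_eq0 negb_or => /andP[_ q0].
  exact: (mulIf q0 E).
have half (y : R) : 0 < y -> y <= delta ->
    normc C' * y ^+ m' = normc C * y ^+ m /\ t' = t.
  move=> y0 yd; have yn0 := lt0r_neq0 y0.
  have e1 := eqn y yn0; rewrite gtr0_norm// in e1; have {}e1 := e1 yd.
  have e2 := eqn (- y); rewrite oppr_eq0 normrN gtr0_norm// in e2; have {}e2 := e2 yn0 yd.
  rewrite !mulNr !opprK in e2.
  set p := normc C * y ^+ m in e1 e2 *; set p' := normc C' * y ^+ m' in e1 e2 *.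
  have p0 : 0 <= p by rewrite mulr_ge0 ?normc_ge0// exprn_ge0// ltW.
  have p'0 : 0 <= p' by rewrite mulr_ge0 ?normc_ge0// exprn_ge0// ltW.
  (* Multiplying the equations at [y] and [- y] cancels the exponentials; [p] and [p'] are
     nonnegative. *)
  have pp : p' = p.
    apply/eqP; rewrite -(@eqrXn2 _ 2)//; apply/eqP.
    have prod (s r : R) : r ^+ 2 = (r * expR (- s)) * (r * expR s).
      by rewrite mulrACA -expRD addNr expR0 mulr1 expr2.
    by rewrite (prod (y * t')) (prod (y * t)) e1 e2.
  split=> //.
  have pn0 : p != 0.
    apply/eqP => pz; have : F (0 +i* y) != 0.
      apply: Fn0; last by rewrite normc_imag gtr0_norm.
      by rewrite -normc_eq0 normc_imag normr_eq0.
    have [q _ Fq] := product_form_norm pF y.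
    by rewrite -normc_eq0 Fq gtr0_norm// -/p pz !mul0r eqxx.
  by move: e2; rewrite pp => /(mulfI pn0)/expR_inj/(mulfI yn0).
have [h1 tt] := half delta d0 (lexx _); split=> //.
have d2 : 0 < delta / 2 by rewrite divr_gt0.
have [h2 _] := half (delta / 2) d2 ltac:(lra).
have c0 : normc C * delta ^+ m != 0.
  have [q _ Fq] := product_form_norm pF delta.
  have : F (0 +i* delta) != 0.
    apply: Fn0; last by rewrite normc_imag gtr0_norm.
    by rewrite -normc_eq0 normc_imag normr_eq0 gt_eqF.
  by rewrite -normc_eq0 Fq gtr0_norm// !mulf_eq0 !negb_or => /andP[/andP[/andP[-> ->]]].
(* The ratio of the equations at [delta / 2] and [delta] is [(1/2)^m' = (1/2)^m]. *)
have mm : m' = m.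
  move: h2; rewrite !exprMn !mulrA h1 => /(mulfI c0).
  by apply: ieexprIn; [rewrite invr_gt0 | rewrite lt_eqF// invf_lt1// ltr1n].
by move: h1; rewrite mm => /mulIf; apply; rewrite expf_neq0// gt_eqF.
Qed.

Lemma canonical_nonzero_near0 (C gamma : R[i]) m (u : nat -> R[i]) K (P F : R[i] -> R[i]) :
  C != 0 -> (forall j, normc (u j) <= K / j.+1%:R) ->
  (forall z, ccvg \oo (fun n => canonical_prod u n z) (P z)) ->
  (forall z, F z = C * z ^+ m * cexp (z * gamma) * P z) ->
  exists2 delta : R, 0 < delta & forall z, z != 0 -> normc z <= delta -> F z != 0.
Proof.
move=> C0 uK uP FE.
have K0 : 0 <= K by have := le_trans (normc_ge0 _) (uK 0%N); rewrite divr1.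
(* For this [N] the tail bound at radius 1 is below 1; shrinking the radius to [1 / (N + 1)] keeps
   the whole product at most that far from 1. *)
have [N _ /(_ N (leqnn N))/= tN] := cvgr_lt _ (@cvg_tail_bound R K 1) _ ltr01.
have N1 : 0 < N.+1%:R :> R by rewrite ltr0n.
exists N.+1%:R^-1 => [|z z0 zN]; first by rewrite invr_gt0.
have tz : tail_bound K (normc z) 0 <= tail_bound K 1 N.
  apply: le_trans (tail_bound_mono K0 (normc_ge0 z) zN (leqnn 0)) _.
  rewrite lerD2r ler_expR divr1 exprMn mulr1.
  have r1 : N.+1%:R^-1 <= 1 :> R by rewrite invf_le1// ler1n.
  have r0 : 0 <= N.+1%:R^-1 :> R by rewrite invr_ge0.
  have eK : expR (K * N.+1%:R^-1) <= expR K by rewrite ler_expR ler_piMr.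
  have r2 : N.+1%:R ^- 2 <= N.+1%:R^-1 :> R by rewrite -exprVn expr2 ler_piMr.
  rewrite exprVn [leLHS](_ : _ = 4 * K ^+ 2 * expR (K / N.+1%:R) * N.+1%:R ^- 2); last by ring.
  apply: ler_pM => //.
  - by rewrite mulr_ge0 ?expR_ge0// mulr_ge0// sqr_ge0.
  - by rewrite ler_wpM2l// mulr_ge0// sqr_ge0.
have P0 : P z != 0.
  have dist : normc (P z - 1) <= tail_bound K (normc z) 0.
    apply: (ccvg_le (ccvgB (uP z) (ccvg_cst 1))); apply: filterE => n /=.
    have := canonical_prod_dist z uK (leq0n n).
    by rewrite /canonical_prod big_nil normc1 mul1r.
  apply/eqP => Pz; move: dist; rewrite Pz sub0r normcN normc1 leNgt.
  by rewrite (le_lt_trans tz).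
by rewrite FE mulf_neq0// mulf_neq0 ?cexp_neq0// mulf_neq0// expf_neq0.
Qed.

Lemma laplace_exp_type h T : exp_integrable h -> 0 <= T -> ess_support_le h T ->
  exp_type_series (laplace_coef h) (laplace h).
Proof. by move=> eh T0 /(laplace_series eh T0)[M cM cF]; exists M, T. Qed.

Lemma autocorrelation_exp_type h T : exp_integrable h -> 0 <= T -> ess_support_le h T ->
  exists e, exp_type_series e (autocorrelation h).
Proof.
move=> eh T0 hT; have hs := laplace_exp_type eh T0 hT.
have -> : autocorrelation h = fun z => laplace h z * conjc (laplace h (- conjc z)).
  by apply/funext => z; exact: autocorrelation_laplace.
by eexists; exact: exp_type_seriesM hs (exp_type_series_reflect hs).
Qed.

Lemma autocorrelation_imaginary h (y : R) : exp_integrable h ->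
  autocorrelation h (0 +i* y) = (normc (laplace h (0 +i* y)) ^+ 2)%:C.
Proof.
move=> eh; rewrite autocorrelation_laplace//.
have -> : - conjc (0 +i* y) = 0 +i* y by simpc.
rewrite normc_sqr; case: (laplace _ _) => p r.
by simpc; rewrite !expr2 [r * p]mulrC addNr.
Qed.

(** The order of [A] at [z] is the sum of the orders of [F] at [z] and at [- conj z]. These count
    the [j] with [u_j z = 1] and with [u_j (- conj z) = 1], that is, the entries of the pairs of
    [1 / u_j] equal to [z]. *)
Lemma canonical_zero_counts (C gamma : R[i]) m (u : nat -> R[i]) K (P F A : R[i] -> R[i]) z k :
  C != 0 -> (forall j, normc (u j) <= K / j.+1%:R) ->
  (forall w, ccvg \oo (fun n => canonical_prod u n w) (P w)) ->
  (forall w, F w = C * w ^+ m * cexp (w * gamma) * P w) ->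
  (forall w, A w = F w * conjc (F (- conjc w))) ->
  z != 0 -> zero_order A z k ->
  ([set p | pair_elt (fun j => (u j)^-1) p = z] #= `I_k)%card.
Proof.
move=> C0 uK uP FE AF z0 /zero_order_order_at ordA.
have K0 : 0 <= K by have := le_trans (normc_ge0 _) (uK 0%N); rewrite divr1.
have z'0 : - conjc z != 0 by rewrite oppr_eq0 conjc_eq0.
have ord1 := order_at_canonical C0 uK uP FE z0.
have ord2 := order_at_canonical C0 uK uP FE z'0.
pose Q p := pair_elt (fun j => (u j)^-1) p == z.
have Qfalse j : Q (j, false) = (u j * z == 1).
  (* The inverse of 0 is 0 by convention, which differs from [z]. *)
  rewrite /Q pair_eltE/=; have [->|uj] := eqVneq (u j) 0.
    by rewrite invr0 mul0r eq_sym (negbTE z0) eq_sym (negbTE (oner_neq0 _)).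
  apply/eqP/eqP => [<-|uz]; first by rewrite divff.
  by apply: (mulfI uj); rewrite divff.
have Qtrue j : Q (j, true) = (u j * - conjc z == 1).
  rewrite /Q pair_eltE/=; have [->|uj] := eqVneq (u j) 0.
    by rewrite invr0 (rmorph0 (@conjc R)) oppr0 mul0r eq_sym (negbTE z0) eq_sym (negbTE (oner_neq0 _)).
  apply/eqP/eqP => [<-|uz]; first by rewrite neg_conjK divff.
  by rewrite -[RHS]neg_conjK -(mulKf uj (- conjc z)) uz mulr1.
(* A match [|u_j| |z| = 1] forces [j + 1 <= K |z|], so only indices below [B] count. *)
have [B BK] : exists B : nat, K * normc z <= B%:R.
  by exists (Num.trunc (K * normc z)).+1; apply: ltW; exact: truncnS_gt.
have QB N : (B <= N)%N -> forall p, Q p -> (p.1 < N)%N.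
  move=> BleN [j b] /= Qp; have /eqP uz : normc (u j) * normc z == 1.
    case: b Qp; rewrite (Qtrue, Qfalse) => /eqP uz.
      by rewrite -[normc z]normc_conj -(normcN (conjc z)) -normcM uz normc1.
    by rewrite -normcM uz normc1.
  have j1 : 0 < j.+1%:R :> R by rewrite ltr0n.
  have : j.+1%:R <= B%:R :> R.
    apply: le_trans BK.
    have -> : j.+1%:R = normc (u j) * j.+1%:R * normc z by rewrite mulrAC uz mul1r.
    by rewrite ler_wpM2r ?normc_ge0// -ler_pdivlMr// uK.
  by rewrite ler_nat => jB; exact: leq_trans BleN.
have -> : [set p | pair_elt (fun j => (u j)^-1) p = z] = [set p | Q p].
  by apply/seteqP; split=> p /eqP.
near \oo => N.
have BleN : (B <= N)%N by near: N; exact: nbhs_infty_ge.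
have -> : k = (\sum_(0 <= j < N) (Q (j, false) + Q (j, true)))%N.
  rewrite big_split/=; apply: (order_at_unique ordA).
  under eq_fun do rewrite AF normcM normc_conj.
  apply: order_atM.
    by under eq_bigr do rewrite Qfalse; near: N.
  apply: (@order_at_conj _ (fun w => normc (F w))).
  by under eq_bigr do rewrite Qtrue; near: N.
exact: card_pair_pred (QB N BleN).
Unshelve. all: end_near. Qed.

Lemma exp_type_nonzero c F A z k : exp_type_series c F ->
  (forall w, A w = F w * conjc (F (- conjc w))) -> zero_order A z k ->
  exists n, c n != 0.
Proof.
move=> [M [T [_ _ cF]]] AF /zero_order_order_at ordA.
apply: contrapT => nc; have F0 w : F w = 0.
  apply: ccvg_unique (cF w) _; apply: eq_ccvg (ccvg_cst 0) => n.
  rewrite big1// => j _; have [->|cj] := eqVneq (c j) 0; first by rewrite mul0r.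
  by case: nc; exists j.
have A0 w : normc (A w) = 0 by rewrite AF F0 mul0r normc0.
(* An identically zero [A] would have order both [k] and [k + 1]. *)
have ordA1 := order_atM ordA (order_at_exp z 1).
have AE : (fun w => normc (A w) * normc (w - z) ^+ 1) = (fun w => normc (A w)).
  by apply/funext => w; rewrite A0 mul0r.
rewrite AE in ordA1; have /eqP := order_at_unique ordA ordA1.
by rewrite -[X in X == _]addn0 eqn_add2l.
Qed.

End Factorization.

(** The reciprocals [1 / u_j] from the Hadamard factorization are matched with the zero pairs; [eta]
    lists them in the matched order and the product is rearranged accordingly. The punctured disc
    without zeros serves the uniqueness argument. *)
Lemma laplace_factorization (R : realType) (h : R -> R[i]) (T : R) (xi : nat -> R[i]) :
  exp_integrable h -> 0 <= T -> ess_support_le h T ->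
  zero_pairs (autocorrelation h) xi ->
  exists (C gamma : R[i]) (m : nat) (eta : nat -> R[i]) (delta : R),
    [/\ product_form (laplace h) xi C gamma m eta, 0 < delta &
      forall z, z != 0 -> normc z <= delta -> laplace h z != 0].
Proof.
move=> eh T0 hT [xi0 counts]; have hs := laplace_exp_type eh T0 hT.
have AF z : autocorrelation h z = laplace h z * conjc (laplace h (- conjc z)).
  exact: autocorrelation_laplace.
(* A finite order of the autocorrelation at some point excludes that the transform vanishes
   identically; the point 1 is taken. *)
have [k1 zo1 _] := counts 1 (oner_neq0 _).
have [C [gamma [m [u [K [P [C0 uK uP FE]]]]]]] :=
  exp_type_factorization hs (exp_type_nonzero hs AF zo1).
have [delta d0 dP] := canonical_nonzero_near0 C0 uK uP FE.
pose v j := (u j)^-1.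
have [sigma [inj sP surj]] : exists sigma : nat -> nat, [/\ injective sigma,
    forall j, v (sigma j) != 0 /\ (v (sigma j) = xi j \/ v (sigma j) = - conjc (xi j)) &
    forall i, v i != 0 -> exists j, sigma j = i].
  apply: matching_of_pair_counts => // z z0; have [k zo kxi] := counts z z0.
  exists k; split=> //; exact: canonical_zero_counts C0 uK uP FE AF z0 zo.
exists C, gamma, m, (fun j => v (sigma j)), delta; split=> //; split=> [j|zeta].
  by have [] := sP j.
exists (P zeta) => //; apply/cvg_ccvgP.
have surj' i : u i != 0 -> exists j, sigma j = i.
  by move=> ui; apply: surj; rewrite invr_eq0.
apply: eq_ccvg (matching_rearrangement uK inj surj' (uP zeta)) => n.
by apply: eq_bigr => j _; rewrite /v invrK mulrC.
Qed.

(** The constants [rho] and [tau] precede [g], hence are common to all admissible signals, and the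
    last clause covers every representation of the given form. *)
Theorem theorem3p2 (R : realType) (a b c d : R) (s : R[i])
    (f : R -> R[i]) (xi : nat -> R[i])
    (hdet : a * d - b * c = 1) (hb : b != 0) (hs : sqrt_2pib b s)
    (hf : L2_compact_support f)
    (hf0 : ~ {ae @lebesgue_measure R, forall t, f t = 0})
    (hxi : zero_pairs (autocorrelation (theta_chirp s a b f)) xi) :
  exists rho tau : R, forall g : R -> R[i],
    L2_compact_support g ->
    (forall omega : R, `|LCT s a b d g omega| = `|LCT s a b d f omega|) ->
    (exists (C gamma : R[i]) (m : nat) (eta : nat -> R[i]),
       product_form (laplace (theta_chirp s a b g)) xi C gamma m eta) /\
    (forall (C gamma : R[i]) (m : nat) (eta : nat -> R[i]),
       product_form (laplace (theta_chirp s a b g)) xi C gamma m eta ->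
       `|C| = rho%:C /\ complex.Im gamma = tau).
Proof.
have [ef [Tf Tf0 fT]] := L2_compact_support_exp_integrable hf.
have eh := theta_chirp_exp_integrable s a b ef.
have hT := theta_chirp_ess_support s a b fT.
have [C0 [gamma0 [m0 [eta0 [delta [pF d0 dP]]]]]] := laplace_factorization eh Tf0 hT hxi.
(* The factorization for [f] itself provides the reference constants. *)
exists (normc C0), (complex.Im gamma0) => g hg LCTeq.
have [eg [Tg Tg0 gT]] := L2_compact_support_exp_integrable hg.
have ehg := theta_chirp_exp_integrable s a b eg.
have hgT := theta_chirp_ess_support s a b gT.
have normeq (y : R) : normc (laplace (theta_chirp s a b g) (0 +i* y)) =
    normc (laplace (theta_chirp s a b f) (0 +i* y)).
  (* The frequency [y b] is chosen so that [omega / b = y]. *)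
  have := LCTeq (y * b); rewrite !normr_normc => /complexI.
  by rewrite !(normc_LCT s a d (y * b) hb)// mulfK.
(* Both sides are series of exponential type that equal the same squared moduli on the imaginary
   axis, so they agree everywhere. *)
have Aeq : autocorrelation (theta_chirp s a b g) = autocorrelation (theta_chirp s a b f).
  have [e1 s1] := autocorrelation_exp_type ehg Tg0 hgT.
  have [e2 s2] := autocorrelation_exp_type eh Tf0 hT.
  apply/funext => z; apply/eqP; rewrite -subr_eq0; apply/eqP.
  apply: (exp_type_series_ext (exp_type_seriesB s1 s2)) => y.
  by rewrite !autocorrelation_imaginary// normeq subrr.
split.
  (* The zero pairs given for [f] thereby become zero pairs for [g]. *)
  rewrite -Aeq in hxi.
  have [C [gamma [m [eta [_ [pG _ _]]]]]] := laplace_factorization ehg Tg0 hgT hxi.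
  by exists C, gamma, m, eta.
move=> C gamma m eta pG.
by rewrite normr_normc; have [-> ->] := product_form_unique pF pG normeq d0 dP.
Qed.
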